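(* Let $D\in\mathbb{T}[x_1,\dots,x_k]^{n\times n}$ be the weighted adjacency matrix of a directed graph with $n$ nodes and $m$ arcs. Suppose that $D$ is generic and has separated variables (with lower and upper bounds), and let $t\in[n]$ be some node. Let $\sigma=\sigma(D,t)$ be the number of shortest-path trees with target node $t$. Then $$\sigma\ \le\ \min\left(\Phi(n,k),\ n^{n-2},\ \binom{m}{n-1}\right),\qquad\text{where}\quad \Phi(n,k)=\sum_{i=0}^{k}\binom{k}{i}(i+1)^{n-i-1},$$ and the graph traversal algorithm described in the context computes the shortest-path trees together with an inequality description for each region of $D^*$ (with respect to the target $t$) in $O(k\cdot m^2\cdot\sigma+n^2)$ time. The space complexity is bounded by $O(k\cdot(n+m)\cdot\sigma)$.
   Context: $\mathbb{T}=\mathbb{R}\cup\{\infty\}$ is the $(\min,+)$-semiring; $[n]=\{1,\dots,n\}$. The directed graph has no parallel arcs. Each arc $(u,v)$ has a weight interval $[\lambda_{uv},\mu_{uv}]$ with $0\le\lambda_{uv}\le\mu_{uv}\le\infty$ (a ray $[\lambda_{uv},\infty)$ if $\mu_{uv}=\infty>\lambda_{uv}$; $\lambda_{uv}=\mu_{uv}=\infty$ signals that the arc is absent). Separated variables with lower and upper bounds: exactly $k$ arcs have $\lambda_{uv}<\mu_{uv}$, they correspond bijectively to the variables $x_1,\dots,x_k$ (with bounds $\lambda_i<\mu_i$), the entry $d_{uv}$ of $D$ is the corresponding variable if $\lambda_{uv}<\mu_{uv}$, and is the constant $\lambda_{uv}$ otherwise. If not specified, $\lambda_i=0$ and $\mu_i=\infty$.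 The feasible domain is the polyhedron $B=[\lambda_1,\mu_1]\times\dots\times[\lambda_k,\mu_k]\subset\mathbb{R}^k$. For tropical polynomials, $f\le g$ means $f(z)\le g(z)$ for all $z\in B$; $f<g$ means $f\le g$ and not $g\le f$; incomparable means neither $f\le g$ nor $g\le f$. $D$ is generic if in $W=\{d_{vw}:\ d_{vw}\text{ constant arc weight}\}\cup\{\lambda_i: i\in[k]\}\cup\{\mu_i: i\in[k],\mu_i<\infty\}$ the elements are pairwise distinct and any two distinct subsets of $W$ (of any cardinalities) have distinct sums. A spanning tree $T$ with all edges directed toward $t$ is a shortest-path tree (with target $t$) if $d_{vw}+p_w\not<p_v$ for every arc $(v,w)$, where $p_v=p_v^T$ is the length of the path from $v$ to $t$ in $T$. Its cell is the polyhedron of parameters in $B$ satisfying $p_v\le d_{vw}+p_w$ for all arcs $(v,w)$. The Kleene star is $D^*=I\oplus D\oplus D^{\odot 2}\oplus\cdots$; its $(v,t)$ entry is the minimum of the lengths of the paths from $v$ to $t$. The regions with respect to $t$ are the full-dimensional cells of the common refinement of the domains of linearity of the entries in column $t$ of $D^*$. Graph traversal algorithm. Initialization: set each $x_i$ to $\lambda_i$, run Dijkstra's algorithm for target $t$, and let $T$ be the resulting tree, re-equipped with the original weights, with parameterized distances $p_u^T$. Put $(T,p^T)$ in a queue $Q$. While $Q$ is nonempty, remove the next $(T,p^T)$. For every arc $(v,w)$ compare $p_v^T$ with $d_{vw}+p_w^T$; if they are incomparable, add $p_v^T\le d_{vw}+p_w^T$ to the system of inequalities of $T$, and let $T'$ be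 obtained from $T$ by replacing the outgoing arc of $v$ by $(v,w)$; compute $p^{T'}$, check whether $T'$ is a shortest-path tree, and if so and if it was not considered before, add it to $Q$. When no arc is left to compare, output $T$, $p^T$ and the system of inequalities describing the region of $T$. Complexity is in the unit cost model.
   Formalization: The algorithm is shown to output only shortest-path trees, including all with a full-dimensional cell, and to describe every region; it can miss shortest-path trees with empty cell, so ''all'' fails. The space bound uses max(k,1) and max(σ,1), as it would be 0 for k=0 or σ=0. *)

(* Defs.v *)
From HB Require Import structures.
From mathcomp Require Import all_boot all_order all_algebra.
From mathcomp Require Import all_classical all_reals all_analysis.

Set Implicit Arguments.
Unset Strict Implicit.
Unset Printing Implicit Defensive.

Import Order.TTheory GRing.Theory Num.Theory.
Import numFieldNormedType.Exports.

Local Open Scope classical_set_scope.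
Local Open Scope ring_scope.

(* An entry of D: no arc, a constant, or a variable.  An entry with weight
   interval [lambda, mu] is [Const lambda] if lambda = mu < +oo, [Infty] if
   lambda = mu = +oo, and [Var i] if lambda < mu, where the interval is then
   kept as the bounds [lo i], [up i] of the i-th variable. *)
Inductive weight (R : Type) (k : nat) := Infty | Const of R | Var of 'I_k.
Arguments Infty {R k}.
Arguments Const {R k}.
Arguments Var {R k}.

Record network (R : realType) (n k : nat) := Network {
  D : 'M[weight R k]_n ;
  lo : 'I_k -> R ;
  up : 'I_k -> \bar R }.

(* The tropical monomial c (.) x_1^a_1 (.) ... (.) x_k^a_k, that is the linear
   form c + \sum_i a_i x_i.  Tropical multiplication is the canonical
   (componentwise) addition of this product type. *)
Notation monomial R k := (R * {ffun 'I_k -> nat})%type.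

Section Definitions.
Variables (R : realType) (n k : nat) (G : network R n k).
Implicit Types (t u v w : 'I_n) (z : 'rV[R]_k) (f g : monomial R k).

Definition is_arc v w : bool := if D G v w is Infty then false else true.

Definition arcs : {set 'I_n * 'I_n} := [set a | is_arc a.1 a.2].

Definition separated_variables : Prop :=
  [/\ forall v w c, D G v w = Const c -> 0 <= c,
      forall i, 0 <= lo G i /\ ((lo G i)%:E < up G i)%E
    & forall i, exists! a : 'I_n * 'I_n, D G a.1 a.2 = Var i].

(* The family W is indexed by the constant arcs, the lower bounds, and the
   finite upper bounds. *)
Definition Windex : finType := ('I_n * 'I_n + ('I_k + 'I_k))%type.

Definition Wdom : {set Windex} := [set j : Windex | match j with
  | inl a => if D G a.1 a.2 is Const _ then true else false
  | inr (inl _) => true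
  | inr (inr i) => (up G i < +oo)%E
  end].

Definition Wval (j : Windex) : R := match j with
  | inl a => if D G a.1 a.2 is Const c then c else 0
  | inr (inl i) => lo G i
  | inr (inr i) => fine (up G i)
  end.

Definition generic : Prop :=
  {in Wdom &, injective Wval} /\
  forall A B : {set Windex}, A \subset Wdom -> B \subset Wdom -> A <> B ->
    \sum_(j in A) Wval j <> \sum_(j in B) Wval j.

Definition feasible : set 'rV[R]_k :=
  [set z | forall i, lo G i <= z 0 i /\ ((z 0 i)%:E <= up G i)%E].

Definition meval f z : R := f.1 + \sum_i z 0 i *+ f.2 i.

Definition mle f g : Prop := forall z, feasible z -> meval f z <= meval g z.
Definition mlt f g : Prop := mle f g /\ ~ mle g f.

(* The value at [Infty] is never used: lengths are only taken along arcs. *)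
Definition wmono (x : weight R k) : monomial R k := match x with
  | Infty => 0
  | Const c => (c, 0)
  | Var i => (0, [ffun j => (j == i) : nat])
  end.

Definition spanning_tree t (T : {set 'I_n * 'I_n}) : Prop :=
  [/\ T \subset arcs,
      forall w, (t, w) \notin T,
      forall v, v != t -> exists! w, (v, w) \in T
    & forall v, connect (fun u w => (u, w) \in T) v t].

Definition next (T : {set 'I_n * 'I_n}) v : 'I_n :=
  odflt v [pick w | (v, w) \in T].

(* Length of the path v, next v, next (next v), ... of T, up to the root t; in
   a spanning tree it has fewer than n arcs, and [next T t = t]. *)
Definition tdist t (T : {set 'I_n * 'I_n}) v : monomial R k :=
  \sum_(j < n | iter j (next T) v != t)
    wmono (D G (iter j (next T) v) (iter j.+1 (next T) v)).

Definition shortest_path_tree t (T : {set 'I_n * 'I_n}) : Prop :=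
  spanning_tree t T /\
  forall v w, is_arc v w ->
    ~ mlt (wmono (D G v w) + tdist t T w) (tdist t T v).

Definition SPT t : {set {set 'I_n * 'I_n}} :=
  [set T : {set 'I_n * 'I_n} | `[< shortest_path_tree t T >]].

Definition cell t (T : {set 'I_n * 'I_n}) : set 'rV[R]_k :=
  [set z | feasible z /\ forall v w, is_arc v w ->
     meval (tdist t T v) z <= meval (wmono (D G v w) + tdist t T w) z].

Definition weval z (x : weight R k) : \bar R := match x with
  | Infty => +oo%E
  | Const c => c%:E
  | Var i => (z 0 i)%:E
  end.

Definition trop_one : 'M[\bar R]_n :=
  \matrix_(i, j) (if i == j then 0%E else +oo%E).

Definition trop_mul (A B : 'M[\bar R]_n) : 'M[\bar R]_n :=
  \matrix_(i, j) \big[Order.min/+oo%E]_(l < n) (A i l + B l j)%E.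

Definition kleene_star (A : 'M[\bar R]_n) (v t : 'I_n) : \bar R :=
  ereal_inf (range (fun r : nat => iter r (trop_mul A) trop_one v t)).

(* On B the entries of D^* are concave and piecewise linear, so that a domain
   of linearity is the locus where the entry agrees with an affine function,
   provided that this locus is full-dimensional.  An infinite entry agrees with
   no affine function. *)
Definition region t (S : set 'rV[R]_k) : Prop :=
  interior S !=set0 /\
  exists (c : 'I_n -> R) (a : 'I_n -> 'rV[R]_k),
    S = [set z | feasible z /\ forall v,
           kleene_star (map_mx (weval z) (D G)) v t =
           (c v + \sum_i a v 0 i * z 0 i)%:E].

End Definitions.

(* For i >= n the exponent is negative. *)
Definition Phi (n k : nat) : rat :=
  \sum_(i < k.+1) ('C(k, i))%:R * (i.+1%:R : rat) ^ (n%:Z - i%:Z - 1).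

(* Unit cost model.  A computation is run from the number of memory words in
   use; it returns its value, the number of elementary operations performed,
   the number of words in use at the end and the maximum of that number on the
   way.  The programs below follow these rules:
   - [op x] performs one elementary operation: an arithmetic operation or a
     comparison of two numbers or nodes, a Boolean operation, a read or a write
     of one table entry or record field, an access to one end of a list, the
     length of a list, or the construction of one record;
   - branching on a value already obtained, and forming tuples of local
     variables or taking them apart, is free;
   - a loop is charged one operation per iteration;
   - [alloc s] reserves and initialises s words, for s operations; [free s]
     releases s words.
   A table entry or a list item holding a monomial or a table is a pointer;
   a monomial occupies k + 1 words.  The input (D, lo, up) is read-only and is
   not counted as memory. *)
Record outcome (A : Type) := Outcome {
  value : A ; time : nat ; live : nat ; peak : nat }.

Definition comp (A : Type) := nat -> outcome A.

Definition ret A (x : A) : comp A := fun l => Outcome x 0 l l.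

Definition bind A B (c : comp A) (f : A -> comp B) : comp B := fun l =>
  let r := c l in
  let r' := f (value r) (live r) in
  Outcome (value r') (time r + time r') (live r') (maxn (peak r) (peak r')).

Definition op A (x : A) : comp A := fun l => Outcome x 1 l l.

Definition alloc (s : nat) : comp unit := fun l =>
  Outcome tt s (l + s) (l + s).

Definition free (s : nat) : comp unit := fun l => Outcome tt 1 (l - s) l.

Notation "'let*' x ':=' c 'in' d" := (bind c (fun x => d))
  (at level 200, x name, c at level 200, d at level 200, right associativity,
   format "'[v' 'let*'  x  ':='  c  'in' '/' d ']'").
Notation "'do*' c 'in' d" := (bind c (fun _ => d))
  (at level 200, c at level 200, d at level 200, right associativity,
   format "'[v' 'do*'  c  'in' '/' d ']'").

Fixpoint for_each (I S : Type) (s : seq I) (st : S) (f : S -> I -> comp S) :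
    comp S :=
  if s is i :: s' then
    do* op tt in
    let* st' := f st i in
    for_each s' st' f
  else ret st.

Definition upd (I : finType) (A : Type) (f : {ffun I -> A}) (i : I) (x : A) :
  {ffun I -> A} := [ffun j => if j == i then x else f j].

(* Prefix tree storing a set of words over 'I_n: first letter, subtree of the
   remainders of the words starting with that letter, and the words starting
   with other letters.  A node occupies 3 words. *)
Inductive trie (n : nat) := Nil | Branch of 'I_n & trie n & trie n.
Arguments Nil {n}.

Section Algorithm.
Variables (R : realType) (n k : nat) (G : network R n k) (t : 'I_n).
Implicit Types (v w : 'I_n) (f g : monomial R k).

Local Notation node := 'I_n.
Local Notation arc := ('I_n * 'I_n)%type.
Local Notation parents := {ffun 'I_n -> 'I_n}.
Local Notation dists := {ffun 'I_n -> monomial R k}.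

Definition dist_size : nat := n + n * k.+1.

Definition arc_list : comp (seq arc) :=
  for_each (enum 'I_n) [::] (fun l v =>
    for_each (enum 'I_n) l (fun l w =>
      let* x := op (D G v w) in
      match x with
      | Infty => ret l
      | _ => do* alloc 2 in op (rcons l (v, w))
      end)).

(* Decides f <= g on B by minimising the linear form g - f over the box B. *)
Definition compare f g : comp bool :=
  let* c1 := op g.1 in
  let* c2 := op f.1 in
  let* c := op (c1 - c2) in
  let* r := for_each (enum 'I_k) c%:E (fun acc i =>
    let* a := op (f.2 i) in
    let* b := op (g.2 i) in
    let* le := op (a <= b)%N in
    if le then
      let* d := op (b - a)%N in
      let* l := op (lo G i) in
      let* y := op (l *+ d) in
      op (acc + y%:E)%E
    else
      let* d := op (a - b)%N in
      let* u := op (up G i) in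
      let* y := op ((d%:R)%:E * u)%E in
      op (acc - y)%E) in
  op (0 <= r)%E.

(* The monomial x + f, for an arc weight x. *)
Definition add_weight (x : weight R k) f : comp (monomial R k) :=
  do* alloc k.+1 in
  let* c0 := op f.1 in
  let* c := (if x is Const c1 then op (c1 + c0) else ret c0) in
  let* e := for_each (enum 'I_k) [ffun=> 0%N] (fun e i =>
    let* y := op (f.2 i) in
    op (upd e i y)) in
  if x is Var i then
    let* y := op (e i) in
    let* y' := op y.+1 in
    let* e' := op (upd e i y') in
    ret (c, e')
  else ret (c, e).

(* A tree is stored as a table of parents together with a list of its nodes in
   which parents precede children. *)
Definition distances (ord : seq node) (par : parents) : comp dists :=
  do* alloc n in
  for_each ord [ffun=> 0] (fun p v =>
    let* b := op (v == t) in
    if b then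
      do* alloc k.+1 in
      op (upd p v 0)
    else
      let* w := op (par v) in
      let* x := op (D G v w) in
      let* q := op (p w) in
      let* f := add_weight x q in
      op (upd p v f)).

(* Dijkstra's algorithm for the target t, with every variable at its lower
   bound.  Returns the nodes that can reach t, in the order in which they are
   settled, and their parents. *)
Definition dijkstra : comp (seq node * parents) :=
  do* alloc (4 * n) in
  let* dist0 := op (upd [ffun=> +oo%E : \bar R] t 0%E) in
  let* st := for_each (enum 'I_n)
      (dist0, [ffun=> t], [ffun=> false], [::] : seq node)
    (fun st _ =>
      let: (dist, par, settled, ord) := st in
      let* best := for_each (enum 'I_n) None (fun best u =>
        let* s := op (settled u) in
        if s then ret best else
        let* d := op (dist u) in
        let* d0 := (if best is Some u0 then op (dist u0) else ret +oo%E) in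
        let* c := op (d < d0)%E in
        ret (if c then Some u else best)) in
      if best is Some u then
        let* settled' := op (upd settled u true) in
        let* ord' := op (rcons ord u) in
        let* d := op (dist u) in
        let* dp := for_each (enum 'I_n) (dist, par) (fun dp v =>
          let: (dist, par) := dp in
          let* s := op (settled' v) in
          if s then ret dp else
          let* x := op (D G v u) in
          let* y := match x with
                    | Infty => ret +oo%E
                    | Const c => ret c%:E
                    | Var i => op (lo G i)%:E
                    end in
          let* d' := op (y + d)%E in
          let* dv := op (dist v) in
          let* c := op (d' < dv)%E in
          if c then
            let* dist' := op (upd dist v d') in
            let* par' := op (upd par v u) in
            ret (dist', par')
          else ret dp) in
        ret (dp.1, dp.2, settled', ord')
      else ret st) in
  let: (_, par, _, ord) := st in
  do* free (2 * n) in
  ret (ord, par).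

Definition is_shortest (al : seq arc) (p : dists) : comp bool :=
  for_each al true (fun ok a =>
    let* v := op a.1 in
    let* w := op a.2 in
    let* x := op (D G v w) in
    let* q := op (p w) in
    let* r := op (p v) in
    let* f := add_weight x q in
    let* fr := compare f r in
    let* rf := compare r f in
    do* free k.+1 in
    let* b := op (fr ==> rf) in
    op (ok && b)).

(* Replaces the outgoing arc of v by (v, w): the nodes of the subtree of v are
   marked and moved to the end of the list of nodes. *)
Definition pivot (ord : seq node) (par : parents) v w :
    comp (seq node * parents) :=
  do* alloc n in
  let* mark := for_each ord [ffun=> false] (fun mark u =>
    let* b := op (u == v) in
    if b then op (upd mark u true) else
    let* y := op (par u) in
    let* b := op (mark y) in
    op (upd mark u b)) in
  do* alloc n in
  let* par1 := for_each (enum 'I_n) [ffun=> t] (fun par1 u =>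
    let* y := op (par u) in
    op (upd par1 u y)) in
  let* par2 := op (upd par1 v w) in
  do* alloc n in
  let* ord1 := for_each ord [::] (fun o u =>
    let* b := op (mark u) in
    if b then ret o else op (rcons o u)) in
  let* ord2 := for_each ord ord1 (fun o u =>
    let* b := op (mark u) in
    if b then op (rcons o u) else ret o) in
  do* free n in
  ret (ord2, par2).

(* The trees already considered are stored in a trie, a tree being the word of
   the parents of the nodes 0, ..., n - 1. *)
Fixpoint lookup (par : parents) (T : trie n) (us : seq node) : comp bool :=
  match T, us with
  | Branch a T1 T2, u :: us' =>
      let* x := op (par u) in
      let* b := op (a == x) in
      if b then (if us' is [::] then ret true else lookup par T1 us')
      else lookup par T2 us
  | _, _ => op false
  end.

Fixpoint chain (par : parents) (us : seq node) : comp (trie n) :=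
  if us is u :: us' then
    do* alloc 3 in
    let* x := op (par u) in
    let* T := chain par us' in
    op (Branch x T Nil)
  else op Nil.

Fixpoint insert (par : parents) (T : trie n) (us : seq node) : comp (trie n) :=
  match T, us with
  | Branch a T1 T2, u :: us' =>
      let* x := op (par u) in
      let* b := op (a == x) in
      if b then let* T1' := insert par T1 us' in op (Branch a T1' T2)
      else let* T2' := insert par T2 us in op (Branch a T1 T2')
  | _, _ => chain par us
  end.

Definition item : Type := (seq node * parents * dists)%type.

(* A tree, its parameterized distances, and a system of inequalities, each pair
   (f, g) standing for f <= g. *)
Definition result : Type :=
  (parents * dists * seq (monomial R k * monomial R k))%type.

(* Treats one tree: returns the new queue, the new set of trees considered, and
   the system of inequalities of the tree. *)
Definition process (al : seq arc) (x : item) (Q : seq item) (seen : trie n) :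
    comp (seq item * trie n * seq (monomial R k * monomial R k)) :=
  let: (ord, par, p) := x in
  for_each al (Q, seen, [::]) (fun st a =>
    let: (Q, seen, sys) := st in
    let* v := op a.1 in
    let* w := op a.2 in
    let* x := op (D G v w) in
    let* q := op (p w) in
    let* r := op (p v) in
    let* f := add_weight x q in
    let* rf := compare r f in
    let* fr := compare f r in
    let* cmp := op (rf || fr) in
    if cmp then do* free k.+1 in ret st else
    do* alloc 2 in
    let* sys' := op (rcons sys (r, f)) in
    let* op' := pivot ord par v w in
    let: (ord', par') := op' in
    let* p' := distances ord' par' in
    let* ok := is_shortest al p' in
    let* old := (if ok then lookup par' seen (enum 'I_n) else ret true) in
    if old then do* free (2 * n + dist_size) in ret (Q, seen, sys') else
    let* seen' := insert par' seen (enum 'I_n) in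
    do* alloc 3 in
    let* Q' := op (rcons Q (ord', par', p')) in
    ret (Q', seen', sys')).

(* The loop ends when the queue is empty; the result is [None] if this does not
   happen within the given number of iterations. *)
Fixpoint main_loop (fuel : nat) (al : seq arc) (Q : seq item) (seen : trie n)
    (out : seq result) : comp (option (seq result)) :=
  if fuel is fuel'.+1 then
    do* op tt in
    if Q is (ord, par, p) :: Q0 then
      let* st := process al (ord, par, p) Q0 seen in
      let: (Q', seen', sys) := st in
      do* free n in
      let* out' := op (rcons out (par, p, sys)) in
      main_loop fuel' al Q' seen' out'
    else ret (Some out)
  else ret None.

(* If some node cannot reach t, there is no spanning tree and the queue is
   empty from the beginning. *)
Definition graph_traversal (fuel : nat) : comp (option (seq result)) :=
  let* al := arc_list in
  let* op' := dijkstra in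
  let: (ord, par) := op' in
  let* s := op (size ord) in
  let* b := op (s == n) in
  if b then
    let* p := distances ord par in
    let* seen := insert par Nil (enum 'I_n) in
    do* alloc 3 in
    main_loop fuel al [:: (ord, par, p)] seen [::]
  else main_loop fuel al [::] Nil [::].

Definition tree_of (r : result) : {set 'I_n * 'I_n} :=
  [set a | (a.1 != t) && (a.2 == r.1.1 a.1)].

Definition system_of (r : result) : set 'rV[R]_k :=
  [set z | feasible G z /\
     forall fg, fg \in r.2 -> meval fg.1 z <= meval fg.2 z].

(* A shortest-path tree is defined by comparing p_v with d_vw + p_w for one arc
   at a time, and so its cell may be empty.  The traversal can miss such a tree:
   with t, y, y', v, v', u, u' and the weights
     y -> t : x,       y' -> t : x',
     v -> y : 256,     v' -> y' : 512,    u -> v : 64,    u' -> v' : 128,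
     u -> y' : 4,      u' -> y : 8,       v -> u' : 16,   v' -> u : 32,
   where x >= 1 and x' >= 2, the first six arcs form a shortest-path tree, but
   no tree obtained from it by changing one arc is one.  Hence completeness is
   stated for the trees that have a region. *)
Definition correct_output (out : seq result) : Prop :=
  [/\ uniq [seq tree_of r | r <- out],
      forall r, r \in out ->
        [/\ tree_of r \in SPT G t,
            forall v, r.1.2 v = tdist G t (tree_of r) v
          & system_of r = cell G t (tree_of r)],
      forall T, T \in SPT G t -> interior (cell G t T) !=set0 ->
        exists2 r, r \in out & tree_of r = T
    & forall S, region G t S -> exists2 r, r \in out & system_of r = S].

End Algorithm.

(* Main.v *)
(** The trees of shortest paths are handled as parent functions. At a point z of
    the box call a tree tight if its distances satisfy all the inequalities
    p_v <= d_vw + p_w at z. Genericity makes the distances of distinct paths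
    differ at the lower corner of the box, so that distances of distinct paths
    are distinct linear forms, and a unique tree is tight at that corner, which
    is the one computed by Dijkstra's algorithm. At an interior point z two
    tight trees can be exchanged one arc at a time: every intermediate tree is
    tight at z, hence a shortest-path tree, and the two lengths compared agree
    at z without being equal, so that they are incomparable on the box and the
    traversal performs the exchange. As z moves along a segment starting from
    the lower corner, the set of parameters with a visited tight tree and the
    set of those with an unvisited one are closed, disjoint, and cover the
    segment; by connectedness every tree that is tight at an interior point is
    visited.

    A shortest-path tree is determined by its variable arcs together with the
    first tail of a variable arc (or t) on the path of each remaining node;
    this gives Phi(n, k). The bound n^(n-2) comes from Pruefer codes. *)

Require Import Defs.
From mathcomp Require Import all_boot all_order all_algebra.
From mathcomp Require Import all_classical all_reals all_analysis.
From mathcomp Require Import zify ring lra.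

Set Implicit Arguments.
Unset Strict Implicit.
Unset Printing Implicit Defensive.

Import Order.TTheory GRing.Theory Num.Theory.
Import numFieldNormedType.Exports.
(* Imported again because classical_sets and ssrfun shadow some of their names. *)
Import boot.fintype boot.finset Defs.

Local Open Scope ring_scope.

(** * Linear forms on the box *)

Section Forms.
Variables (R : realType) (n k : nat) (G : network R n k).
Implicit Types (z : 'rV[R]_k) (f g : monomial R k) (i : 'I_k).

(** Comparability is a statement about the whole box, whereas exchanging arcs is local at a point z.
    The bridge is that an affine form which is nonnegative on the box and vanishes at an interior
    point vanishes identically. It fails at the lower corner, where genericity takes over: lengths
    there are subset sums of W, so that equal lengths mean equal arc sets.

    Regions are reached through a finite cover: the closed sets of parameters at which a given tree
    is tight cover the region, and one of them must contain an open piece, on which the affine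
    functions of the region are the distances of that tree.

    The time bound leaves O(k m) for each candidate tree, including the test whether it is already
    known; in the trie the siblings at a node are heads of distinct arcs with a common tail, so that
    a search meets O(m) letters. For k = 0 only the term n^2 remains; it suffices because all
    lengths are then comparable, nothing is pivoted and sigma is at most 1. For k > 0 there is an
    arc, and a spanning tree gives n <= m + 1 <= 2m, which absorbs n into m. *)

Lemma meval0 z : meval (0 : monomial R k) z = 0.
Proof. by rewrite /meval add0r big1 // => i _; rewrite ffunE mulr0n. Qed.

Lemma mevalD f g z : meval (f + g) z = meval f z + meval g z.
Proof.
rewrite /meval addrACA -big_split /=; congr (_ + _).
by apply: eq_bigr => i _; rewrite ffunE mulrnDr.
Qed.

Lemma mevalB f g z : meval g z - meval f z =
  (g.1 - f.1) + \sum_i ((g.2 i)%:R - (f.2 i)%:R) * z 0 i.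
Proof.
rewrite /meval opprD addrACA; congr (_ + _).
rewrite -sumrB; apply: eq_bigr => i _.
by rewrite mulrBl !mulr_natl.
Qed.

Lemma meval_segment f (s : R) z z' :
  meval f (z + s *: (z' - z)) = meval f z + s * (meval f z' - meval f z).
Proof.
rewrite /meval.
have -> : \sum_i (z + s *: (z' - z)) 0 i *+ f.2 i =
  \sum_i z 0 i *+ f.2 i + s * (\sum_i z' 0 i *+ f.2 i - \sum_i z 0 i *+ f.2 i).
  rewrite -sumrB mulr_sumr -big_split /=; apply: eq_bigr => i _.
  by rewrite !mxE mulrnDl -mulrnBl -mulrnAr.
by ring.
Qed.

Definition lo_point : 'rV[R]_k := \row_i lo G i.

Hypothesis sep : separated_variables G.

Lemma lo_lt_up i : ((lo G i)%:E < up G i)%E.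
Proof. by case: sep => _ /(_ i) []. Qed.

Lemma lo_ge0 i : 0 <= lo G i.
Proof. by case: sep => _ /(_ i) []. Qed.

Lemma feasible_lo_point : feasible G lo_point.
Proof. by move=> i; rewrite mxE lexx ltW // lo_lt_up. Qed.

Definition interior_point z := forall i, lo G i < z 0 i /\ ((z 0 i)%:E < up G i)%E.

Lemma interior_point_feasible z : interior_point z -> feasible G z.
Proof. by move=> zi i; have [? ?] := zi i; rewrite !ltW. Qed.

Lemma interior_point_segment z z' (s : R) : feasible G z -> interior_point z' ->
  0 < s -> s <= 1 -> interior_point (z + s *: (z' - z)).
Proof.
move=> fz iz' s0 s1 i; have [l1 u1] := fz i; have [l2 u2] := iz' i.
rewrite !mxE; split; first by nra.
move: u1 u2; case: (up G i) => [u| |] //=; rewrite ?lte_fin ?lee_fin ?ltry //.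
by move=> ? ?; nra.
Qed.

Definition set_coord z i (x : R) : 'rV[R]_k := \row_j (if j == i then x else z 0 j).

Lemma set_coord_feasible z i x : feasible G z -> lo G i <= x -> (x%:E <= up G i)%E ->
  feasible G (set_coord z i x).
Proof. by move=> fz lx xu j; rewrite mxE; case: eqP => [->|_] //. Qed.

Lemma mevalB_set_coord f g z i x :
  meval g (set_coord z i x) - meval f (set_coord z i x) =
  meval g z - meval f z + ((g.2 i)%:R - (f.2 i)%:R) * (x - z 0 i).
Proof.
rewrite !mevalB -[RHS]addrA; congr (_ + _).
rewrite (bigD1 i) //= [in RHS](bigD1 i) //= mxE eqxx.
have -> : \sum_(j < k | j != i) ((g.2 j)%:R - (f.2 j)%:R) * set_coord z i x 0 j =
  \sum_(j < k | j != i) ((g.2 j)%:R - (f.2 j)%:R) * z 0 j.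
  by apply: eq_bigr => j /negPf ji; rewrite mxE ji.
by ring.
Qed.

(* The difference has a zero coefficient in each coordinate: otherwise it would
   take a negative value when that coordinate is moved one way or the other. *)
Lemma mle_interior_eq f g z : mle G f g -> interior_point z ->
  meval f z = meval g z -> forall y, meval f y = meval g y.
Proof.
move=> fg iz eqz.
have fz := interior_point_feasible iz.
have c0 i : (g.2 i)%:R - (f.2 i)%:R = 0 :> R.
  have [l u] := iz i.
  have /fg : feasible G (set_coord z i (lo G i)).
    by apply: set_coord_feasible => //; rewrite ltW // lo_lt_up.
  rewrite -subr_ge0 mevalB_set_coord eqz subrr add0r => h1.
  have [x zx xu] : exists2 x, z 0 i < x & (x%:E <= up G i)%E.
    move: u; case: (up G i) => [u| |] //; first by rewrite lte_fin => zu; exists u.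
    by move=> _; exists (z 0 i + 1); rewrite ?leey //; lra.
  have /fg : feasible G (set_coord z i x).
    by apply: set_coord_feasible => //; rewrite ltW // (lt_trans l).
  rewrite -subr_ge0 mevalB_set_coord eqz subrr add0r => h2.
  by nra.
move=> y; apply/esym/eqP; rewrite -subr_eq0 mevalB.
have := mevalB f g z; rewrite eqz subrr => e.
by rewrite [X in _ == X]e; apply/eqP; congr (_ + _); apply: eq_bigr => i _; rewrite c0 !mul0r.
Qed.

(* [min_term f g i] is the minimum of the i-th term of g - f over the box. *)
Definition min_term f g i : \bar R :=
  if (f.2 i <= g.2 i)%N then (lo G i *+ (g.2 i - f.2 i))%:E
  else (- (((f.2 i - g.2 i)%N%:R)%:E * up G i))%E.

Lemma min_term_le f g i z : feasible G z ->
  (min_term f g i <= ((((g.2 i)%:R - (f.2 i)%:R) * z 0 i))%:E)%E.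
Proof.
move=> /(_ i) [lz zu]; rewrite /min_term; case: leqP => c.
  by rewrite lee_fin -[lo G i *+ _]mulr_natl natrB // ler_wpM2l // subr_ge0 ler_nat.
have -> : (g.2 i)%:R - (f.2 i)%:R = - ((f.2 i - g.2 i)%N%:R : R).
  by rewrite natrB ?opprB // ltnW.
rewrite mulNr EFinN leeN2 EFinM lee_pmul2l ?lte_fin ?ltr0n ?subn_gt0 //.
Qed.

(** Each coordinate can be minimised on its own. The minimum is attained at a vertex unless a
    negative coefficient meets an infinite upper bound, and then the form is unbounded below. *)
Lemma box_min_correct f g :
  (0%E <= (g.1 - f.1)%:E + \sum_(i <- enum 'I_k) min_term f g i)%E <-> mle G f g.
Proof.
split=> [h z fz|fg].
  rewrite -subr_ge0 -lee_fin mevalB EFinD; apply: le_trans h _.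
  rewrite leeD2l // big_enum /= -sumEFin; apply: lee_sum => i _.
  exact: min_term_le.
(* The vertex that minimises g - f, with each infinite upper bound it would need truncated to
   [lo G i + M]. *)
pose zM (M : R) : 'rV[R]_k := \row_i
  (if (f.2 i <= g.2 i)%N then lo G i else if up G i is u%:E then u else lo G i + M).
have fzM M : 0 <= M -> feasible G (zM M).
  move=> M0 i; rewrite mxE; have := lo_lt_up i.
  case: leqP => _; first by move=> /ltW; rewrite lexx.
  case: (up G i) => [u| |] //=; first by rewrite lte_fin => /ltW ->.
  by move=> _; rewrite leey lerDl.
have [/existsP [i0 /andP[c0 u0]]|/existsPn noi] :=
  boolP [exists i, (g.2 i < f.2 i)%N && (up G i == +oo%E)].
(* The coefficient at i0 is at most -1, so raising the truncation from 0 to M lowers g - f by at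
   least M, which exceeds its absolute value at [zM 0]. *)
- pose M := `|meval g (zM 0) - meval f (zM 0)| + 1.
  have M1 : 0 <= M by rewrite /M addr_ge0.
  have := fg _ (fzM _ M1); rewrite -subr_ge0.
  suff : meval g (zM M) - meval f (zM M) <= meval g (zM 0) - meval f (zM 0) - M.
    move=> h1 h2; exfalso; move: h1 h2.
    by rewrite /M; have := ler_norm (meval g (zM 0) - meval f (zM 0)); lra.
  rewrite !mevalB -[leRHS]addrA lerD2l (bigD1 i0) //= [in leRHS](bigD1 i0) //=.
  rewrite [leRHS]addrAC lerD //.
    rewrite !mxE leqNgt c0 /= (eqP u0).
    have -> : (g.2 i0)%:R - (f.2 i0)%:R = - ((f.2 i0 - g.2 i0)%N%:R : R).
      by rewrite natrB ?opprB // ltnW.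
    have : 1 <= (f.2 i0 - g.2 i0)%N%:R :> R by rewrite ler1n subn_gt0.
    by nra.
  apply: ler_sum => i _; rewrite !mxE.
  case: leqP => // c; case: (up G i) => [u| |] //; rewrite addr0.
    have : (g.2 i)%:R < (f.2 i)%:R :> R by rewrite ltr_nat.
    by nra.
  have : (g.2 i)%:R < (f.2 i)%:R :> R by rewrite ltr_nat.
  by nra.
- have := fg _ (fzM 0 (lexx 0)); rewrite -subr_ge0 -lee_fin mevalB EFinD -sumEFin.
  rewrite big_enum /=; congr (_ <= _)%E; congr (_ + _)%E.
  apply: eq_bigr => i _; rewrite /min_term mxE.
  case: leqP => c; first by rewrite -[lo G i *+ _]mulr_natl natrB.
  have := noi i; rewrite c /=; have := lo_lt_up i; case: (up G i) => [u| |] // _ _.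
  rewrite -EFinM -EFinN -mulNr natrB ?opprB //; exact: ltnW.
Qed.

End Forms.
(** * Trees as parent functions *)

Lemma ffun_iter_fix (n : nat) (f : {ffun 'I_n -> 'I_n}) t j : f t = t -> iter j f t = t.
Proof. by move=> ft; elim: j => //= j ->. Qed.

Section Trees.
Variables (R : realType) (n k : nat) (G : network R n k) (t : 'I_n).
Implicit Types (f g : {ffun 'I_n -> 'I_n}) (u v w x : 'I_n) (z : 'rV[R]_k).

Definition rooted f := f t = t /\ forall v, exists j, iter j f v = t.

Definition intree f := rooted f /\ forall v, v != t -> is_arc G v (f v).

Definition arcset f : {set 'I_n * 'I_n} := [set a | (a.1 != t) && (a.2 == f a.1)].

(* The length p_v^T of the path from v to t, for T = [arcset f]. *)
Definition pd f v : monomial R k :=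
  \sum_(j < n | iter j f v != t) wmono (D G (iter j f v) (iter j.+1 f v)).

Lemma rooted_ind f (P : 'I_n -> Prop) : rooted f ->
  P t -> (forall v, v != t -> P (f v) -> P v) -> forall v, P v.
Proof.
move=> [ft rf] Pt Pf v; have [j] := rf v; elim: j v => [|j IH] v /=; first by move=> ->.
rewrite -iterS iterSr => /IH Pfv; have [->//|vt] := eqVneq v t; exact: Pf.
Qed.

(** If v had period p + 1, the m * (p + 1)-th iterate would be v, although m steps already lead to
    the fixed point t. *)
Lemma rooted_acyclic f v : rooted f -> v != t -> ~~ fconnect f (f v) v.
Proof.
move=> [ft rf] vt; apply/negP => /iter_findex; rewrite -iterSr.
set p := findex _ _ _ => per; have [m hm] := rf v.
have : iter (m * p.+1) f v = v by elim: m {hm} => // m IH; rewrite mulSn iterD IH.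
have -> : (m * p.+1 = m * p + m)%N by rewrite mulnS addnC.
by rewrite iterD hm ffun_iter_fix // => /eqP; rewrite eq_sym (negPf vt).
Qed.

Lemma rooted_iter_max f v j : rooted f -> (n <= j.+1)%N -> iter j f v = t.
Proof.
move=> [ft rf] nj; have [m hm] := rf v.
have c : fconnect f v t by rewrite -hm fconnect_iter.
have : (findex f v t < n)%N.
  by apply: leq_trans (findex_max c) _; rewrite -[leqRHS]card_ord max_card.
move=> lt; rewrite -(@subnK (findex f v t) j); last by rewrite -ltnS (leq_trans lt).
by rewrite iterD iter_findex // ffun_iter_fix.
Qed.

Lemma pd_root f : f t = t -> pd f t = 0.
Proof. by move=> ft; rewrite /pd big_pred0 // => j; rewrite ffun_iter_fix // eqxx. Qed.

Lemma pd_step f v : rooted f -> v != t -> pd f v = wmono (D G v (f v)) + pd f (f v).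
Proof.
move=> rf vt; rewrite /pd.
have [m nE] : exists m, n = m.+1 by exists n.-1; rewrite prednK // (leq_ltn_trans _ (ltn_ord t)).
pose F u j := if iter j f u != t then wmono (D G (iter j f u) (iter j.+1 f u)) else 0.
have E u : \sum_(j < n | iter j f u != t)
    wmono (D G (iter j f u) (iter j.+1 f u)) = \sum_(0 <= j < n) F u j.
  by rewrite big_mkcond /= big_mkord.
have S (H : nat -> monomial R k) : \sum_(0 <= j < n) H j = \sum_(0 <= j < m.+1) H j.
  by rewrite -nE.
rewrite !E [LHS]S big_nat_recl // {1}/F /= vt; congr (_ + _).
(* The sum for [f v] has one summand too many; it vanishes because n - 1 steps lead to t from
   anywhere. *)
rewrite [RHS]S big_nat_recr //= {3}/F rooted_iter_max ?nE // eqxx /= addr0.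
by apply: eq_bigr => j _; rewrite /F -!iterSr.
Qed.

Lemma next_arcset f v : f t = t -> next (arcset f) v = f v.
Proof.
move=> ft; rewrite /next; case: pickP => [w|h] /=.
  by rewrite inE /= => /andP[_ /eqP].
have [->//|vt] := eqVneq v t.
by have := h (f v); rewrite inE /= vt eqxx.
Qed.

Lemma tdist_arcset f v : f t = t -> tdist G t (arcset f) v = pd f v.
Proof.
move=> ft; have E j u : iter j (next (arcset f)) u = iter j f u.
  by elim: j => //= j ->; rewrite next_arcset.
by apply: eq_big => [j|j _]; rewrite ?E.
Qed.

Lemma arcset_inj : {in [pred f : {ffun 'I_n -> 'I_n} | f t == t] &, injective arcset}.
Proof.
move=> f g; rewrite !inE => /eqP ft /eqP gt e; apply/ffunP => v.
by rewrite -[LHS]next_arcset // e next_arcset.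
Qed.

Lemma card_arcset f : #|arcset f| = (n - 1)%N.
Proof.
have -> : arcset f = [set (v, f v) | v in [set~ t]].
  apply/setP => -[v w]; rewrite inE /=; apply/andP/imsetP => [[vt /eqP ->]|[u]].
    by exists v; rewrite // !inE.
  by rewrite !inE => ut [-> ->].
by rewrite card_imset ?cardsC1 ?card_ord ?subn1 //= => u v [].
Qed.

Lemma spanning_tree_arcset f : intree f -> spanning_tree G t (arcset f).
Proof.
move=> [[ft rf] af]; split.
- by apply/fintype.subsetP => -[v w]; rewrite !inE /= => /andP[vt /eqP ->]; exact: af.
- by move=> w; rewrite inE /= eqxx.
- move=> v vt; exists (f v); split; first by rewrite inE /= vt eqxx.
  by move=> w; rewrite inE /= => /andP[_ /eqP].
- apply: (@rooted_ind f) => // v vt; apply: connect_trans; apply: connect1.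
  by rewrite inE /= vt eqxx.
Qed.

(** Outgoing arcs are unique, so [next] reads off a parent function, and a path of T to t is forced
    to follow it. *)
Lemma spanning_treeP (T : {set 'I_n * 'I_n}) :
  spanning_tree G t T -> exists2 f, intree f & T = arcset f.
Proof.
move=> [sT tT uT cT].
have nT v w : v != t -> (v, w) \in T -> next T v = w.
  move=> vt vw; rewrite /next; case: pickP => [w' vw'|/(_ w)]; last by rewrite vw.
  by have [w0 [_ h]] := uT v vt; rewrite /= -(h w) // -(h w').
have nt : next T t = t by rewrite /next; case: pickP => // w; rewrite (negPf (tT w)).
exists [ffun v => next T v].
  split; last first.
    move=> v vt; have [w [vw _]] := uT v vt; rewrite ffunE (nT _ _ vt vw).
    by have := fintype.subsetP sT _ vw; rewrite inE.
  split; first by rewrite ffunE.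
  move=> v; have [p] := connectP (cT v).
  elim: p v => [|w p IH] v /=; first by move=> _ ->; exists 0%N.
  move=> /andP[vw pp] tE; have [j hj] := IH w pp tE; exists j.+1.
  have vt : v != t by apply: contraTneq vw => ->; exact: tT.
  by rewrite iterSr ffunE (nT _ _ vt vw).
apply/setP => -[v w]; rewrite inE /= ffunE.
have [->|vt] /= := eqVneq v t; first by rewrite (negPf (tT w)).
apply/idP/eqP => [/(nT _ _ vt)//|->].
by have [w0 [vw0 _]] := uT v vt; rewrite (nT _ _ vt vw0).
Qed.

Definition spt f := intree f /\
  forall v w, is_arc G v w -> ~ mlt G (wmono (D G v w) + pd f w) (pd f v).

Lemma shortest_path_treeP (T : {set 'I_n * 'I_n}) :
  shortest_path_tree G t T <-> exists2 f, spt f & T = arcset f.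
Proof.
split=> [[/spanning_treeP [f [[ft rf] af] ->] h]|[f [[[ft rf] af] h] ->]].
  by exists f => //; split=> // v w vw; have := h v w vw; rewrite !tdist_arcset.
by split=> [|v w vw]; rewrite ?tdist_arcset //; [exact: spanning_tree_arcset | exact: h].
Qed.

Definition spts : {set {ffun 'I_n -> 'I_n}} := [set f | `[< spt f >]].

Lemma sptsP f : reflect (spt f) (f \in spts).
Proof. by rewrite inE; exact: asboolP. Qed.

Lemma spts_root : {subset spts <= [pred f : {ffun 'I_n -> 'I_n} | f t == t]}.
Proof. by move=> f /sptsP [[[ft _] _] _]; rewrite inE ft. Qed.

Lemma SPT_spts : SPT G t = arcset @: spts.
Proof.
apply/setP => T; rewrite inE; apply/asboolP/imsetP.
  by move=> /shortest_path_treeP [f /sptsP ? ->]; exists f.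
by move=> [f /sptsP ? ->]; apply/shortest_path_treeP; exists f.
Qed.

Lemma card_SPT : #|SPT G t| = #|spts|.
Proof.
rewrite SPT_spts card_in_imset // => f g /spts_root ? /spts_root ?; exact: arcset_inj.
Qed.

Lemma cell_arcset f z : f t = t ->
  cell G t (arcset f) z <-> feasible G z /\ forall v w, is_arc G v w ->
    meval (pd f v) z <= meval (wmono (D G v w)) z + meval (pd f w) z.
Proof.
move=> ft; split=> -[fz h]; split=> // v w /h; by rewrite !tdist_arcset // mevalD.
Qed.

(** The last hypothesis says that w lies outside the subtree of v. Paths starting outside that
    subtree never meet v and are unchanged; all others now pass through v and w. *)
Lemma pivot_intree f v w : intree f -> v != t -> is_arc G v w -> ~~ fconnect f w v ->
  [/\ intree (upd f v w), forall x, ~~ fconnect f x v -> pd (upd f v w) x = pd f x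
    & pd (upd f v w) v = wmono (D G v w) + pd f w].
Proof.
move=> [[ft rf] af] vt vw wv; set f' := upd f v w.
have f'v : f' v = w by rewrite ffunE eqxx.
have f'n x : x != v -> f' x = f x by move=> /negPf xv; rewrite ffunE xv.
have f't : f' t = t by rewrite f'n // eq_sym.
have reach1 x : ~~ fconnect f x v -> exists j, iter j f' x = t.
  elim/(@rooted_ind f): x => //; first by exists 0%N.
  move=> x xt IH; rewrite fconnect_eqVf negb_or => /andP[xv /IH [j hj]].
  by exists j.+1; rewrite iterSr f'n.
have rf' : rooted f'.
  split=> // x; elim/(@rooted_ind f): x => //; first by exists 0%N.
  move=> x xt [j hj]; have [->|xv] := eqVneq x v.
    by have [i hi] := reach1 w wv; exists i.+1; rewrite iterSr f'v.
  by exists j.+1; rewrite iterSr f'n.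
have pdE x : ~~ fconnect f x v -> pd f' x = pd f x.
  elim/(@rooted_ind f): x => //; first by rewrite !pd_root.
  move=> x xt IH; rewrite fconnect_eqVf negb_or => /andP[xv /IH e].
  by rewrite [LHS]pd_step // f'n // e -pd_step.
split=> //; last by rewrite pd_step // f'v pdE.
split=> // x xt; have [->|xv] := eqVneq x v; first by rewrite f'v.
by rewrite f'n //; exact: af.
Qed.

(** * Tight trees, and what genericity gives *)

Hypotheses (sep : separated_variables G) (gen : generic G).

(** Genericity applied to the empty set and {j}: their sums differ, so that no element of W is
    zero. *)
Lemma Wval_gt0 j : j \in Wdom G -> 0 < Wval G j.
Proof.
move=> jW; rewrite lt_neqAle; apply/andP; split; last first.
  case: j jW => [[v w]|[i|i]]; rewrite ?inE /=.
  - by case E: (D G v w) => [|c|i] //= _; have [h _ _] := sep; exact: (h v w).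
  - by move=> _; exact: lo_ge0.
  - move=> ui; have := lo_lt_up sep i; have := lo_ge0 sep i.
    case: (up G i) ui => [u| |] //= _; rewrite lte_fin => l0 lu.
    exact: le_trans l0 (ltW lu).
apply/eqP => j0; have [_ /(_ finset.set0 [set j]%SET)] := gen.
rewrite finset.sub0set finset.sub1set jW big_set0 big_set1 -j0 => /(_ isT isT) h.
by apply: h => // /setP /(_ j); rewrite !inE eqxx.
Qed.

Lemma wmono_gt0 v w z : feasible G z -> is_arc G v w -> 0 < meval (wmono (D G v w)) z.
Proof.
move=> fz; rewrite /is_arc; case E: (D G v w) => [|c|i] // _; rewrite /meval /=.
  rewrite big1 ?addr0; last by move=> i _; rewrite ffunE mulr0n.
  have : inl (v, w) \in Wdom G by rewrite inE /= E.
  by move/Wval_gt0; rewrite /= E.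
rewrite add0r (bigD1 i) //= big1 ?addr0; last first.
  by move=> j /negPf ji; rewrite ffunE ji mulr0n.
rewrite ffunE eqxx mulr1n; have [l _] := fz i; apply: lt_le_trans l.
have : inr (inl i) \in Wdom G by rewrite inE.
by move/Wval_gt0.
Qed.

Lemma pd_next_lt f v z : feasible G z -> intree f -> v != t ->
  meval (pd f (f v)) z < meval (pd f v) z.
Proof.
by move=> fz [rf af] vt; rewrite [X in _ < meval X _]pd_step // mevalD ltrDr wmono_gt0 // af.
Qed.

Lemma pd_ge0 f v z : feasible G z -> intree f -> 0 <= meval (pd f v) z.
Proof.
move=> fz [rf af]; elim/(@rooted_ind f): v => //; first by rewrite pd_root ?meval0 //; case: rf.
by move=> v vt IH; rewrite (le_trans IH) // ltW // pd_next_lt.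
Qed.

Lemma pd_connect f u v z : feasible G z -> intree f -> fconnect f u v ->
  meval (pd f v) z <= meval (pd f u) z.
Proof.
move=> fz itf /iter_findex <-; elim: (findex f u v) => //= j; apply: le_trans.
have [->|nt] := eqVneq (iter j f u) t; last exact/ltW/pd_next_lt.
by case: itf => -[-> _].
Qed.

Definition tight f z := forall v w, is_arc G v w ->
  meval (pd f v) z <= meval (wmono (D G v w)) z + meval (pd f w) z.

(** The distances of a tight tree form a feasible potential, which bounds from below the length of
    every path to t, here the path in g. *)
Lemma tight_le f g z v : intree f -> tight f z -> intree g ->
  meval (pd f v) z <= meval (pd g v) z.
Proof.
move=> [[ft _] _] tf [rg ag]; elim/(@rooted_ind g): v (rg) => //.
  by case=> gt _; rewrite !pd_root.
move=> v vt IH _; rewrite (pd_step rg vt) mevalD.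
by apply: le_trans (tf _ _ (ag v vt)) _; rewrite lerD2l IH.
Qed.

Lemma tight_eq f g z v : intree f -> tight f z -> intree g -> tight g z ->
  meval (pd f v) z = meval (pd g v) z.
Proof. by move=> *; apply/le_anti; rewrite !tight_le. Qed.

(** Distances are nonnegative, do not increase towards the root, and arcs have positive weight; so a
    detour that is not longer can neither leave the root nor enter the subtree of v. *)
Lemma le_arc_not_connect f v w z : feasible G z -> intree f -> is_arc G v w ->
  meval (wmono (D G v w)) z + meval (pd f w) z <= meval (pd f v) z ->
  v != t /\ ~~ fconnect f w v.
Proof.
move=> fz itf vw h; have d0 := wmono_gt0 fz vw; split; last first.
  by apply/negP => /(pd_connect fz itf); lra.
apply/eqP => vt; have [[ft _] _] := itf; have := pd_ge0 w fz itf.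
by move: h; rewrite vt pd_root // meval0 -vt; lra.
Qed.

Lemma pivot_le f v w z : feasible G z -> intree f -> is_arc G v w ->
  meval (wmono (D G v w)) z + meval (pd f w) z <= meval (pd f v) z ->
  intree (upd f v w) /\ forall x, meval (pd (upd f v w) x) z <= meval (pd f x) z.
Proof.
move=> fz itf vw h; have [vt wv] := le_arc_not_connect fz itf vw h.
have [itf' _ pv] := pivot_intree itf vt vw wv; split=> // x.
have [rf' _] := itf'; have [rf _] := itf.
elim/(@rooted_ind (upd f v w)): x (rf') => //.
  by case=> f't _; rewrite !pd_root //; case: rf.
move=> x xt IH _; have [->|xv] := eqVneq x v; first by rewrite pv mevalD.
move: IH; have f'x : upd f v w x = f x by rewrite ffunE (negPf xv).
by rewrite (pd_step rf' xt) (pd_step rf xt) f'x !mevalD lerD2l; apply.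
Qed.

(** Take a tree with the least sum of distances at z. A violated inequality would permit a pivot
    that increases no distance and strictly decreases that of v. *)
Lemma exists_tight f0 z : feasible G z -> intree f0 -> exists2 f, intree f & tight f z.
Proof.
move=> fz itf0; pose P f := `[< intree f >].
have P0 : P f0 by apply/asboolP.
case: (Order.TotalTheory.arg_minP (fun f => \sum_v meval (pd f v) z) P0).
move=> f /asboolP itf fmin; exists f => // v w vw; rewrite leNgt; apply/negP => lt.
have [itf' le] := pivot_le fz itf vw (ltW lt).
have [vt wv] := le_arc_not_connect fz itf vw (ltW lt).
have [_ _ pv] := pivot_intree itf vt vw wv.
have := fmin (upd f v w) (introT (asboolP _) itf').
rewrite leNgt => /negP; apply; rewrite (bigD1 v) //= [ltRHS](bigD1 v) //=.
by rewrite ltr_leD ?pv ?mevalD // ler_sum.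
Qed.

(** The pivot increases no distance at z, and those of f are already least. So the distances at z
    are the same, and tightness depends on nothing else. *)
Lemma pivot_tight f v w z : feasible G z -> intree f -> tight f z -> is_arc G v w ->
  meval (wmono (D G v w)) z + meval (pd f w) z = meval (pd f v) z ->
  intree (upd f v w) /\ tight (upd f v w) z.
Proof.
move=> fz itf tf vw h.
have [itf' le] : intree (upd f v w) /\ forall x, meval (pd (upd f v w) x) z <= meval (pd f x) z.
  by apply: pivot_le => //; rewrite h.
split=> // u u' uu'.
have E x : meval (pd (upd f v w) x) z = meval (pd f x) z.
  by apply/le_anti; rewrite le tight_le.
by rewrite !E; exact: tf.
Qed.

(* The element of the family W that an arc contributes to lengths at the lower
   corner of the box. *)
Definition widx (a : 'I_n * 'I_n) : Windex n k :=
  if D G a.1 a.2 is Var i then inr (inl i) else inl a.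

Lemma widx_inj : {in arcs G &, injective widx}.
Proof.
move=> [v w] [v' w']; rewrite !inE /is_arc /widx /=.
case E: (D G v w) => [|c|i] // _; case E': (D G v' w') => [|c'|i'] // _; case=> //.
  by move=> -> ->.
move=> ii; rewrite -ii in E'; have [_ _ /(_ i) [a [_ h]]] := sep.
by rewrite -(h (v, w)) // -(h (v', w')).
Qed.

Lemma widx_Wdom a : a \in arcs G -> widx a \in Wdom G.
Proof.
case: a => v w; rewrite !inE /is_arc /widx /=; case E: (D G v w) => [|c|i] //= _.
by rewrite E.
Qed.

Lemma Wval_widx a : a \in arcs G -> Wval G (widx a) = meval (wmono (D G a.1 a.2)) (lo_point G).
Proof.
case: a => v w; rewrite !inE /is_arc /widx /meval /=; case E: (D G v w) => [|c|i] //= _.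
  by rewrite E big1 ?addr0 // => i _; rewrite ffunE mulr0n.
rewrite add0r (bigD1 i) //= big1 ?addr0; last first.
  by move=> j /negPf ji; rewrite ffunE ji mulr0n.
by rewrite ffunE eqxx mulr1n mxE.
Qed.

Definition pathset f v : {set 'I_n} := [set u | fconnect f v u && (u != t)].

Lemma meval_pd_lo f v : intree f ->
  meval (pd f v) (lo_point G) = \sum_(u in pathset f v) Wval G (widx (u, f u)).
Proof.
move=> [rf af]; elim/(@rooted_ind f): v (rf) => //.
  case=> ft _; rewrite pd_root // meval0 big1 // => u; rewrite inE => /andP[/iter_findex <-].
  by rewrite ffun_iter_fix ?eqxx.
move=> v vt IH _; rewrite pd_step // mevalD {}IH //.
have vp : v \in pathset f v by rewrite inE connect0.
rewrite [RHS](bigD1 v) //=; congr (_ + _).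
  by rewrite Wval_widx // inE /=; exact: af.
apply: eq_bigl => u; rewrite !inE [in RHS]fconnect_eqVf [v == u]eq_sym.
have [->|uv] := eqVneq u v; last by rewrite orFb andbT.
by rewrite (negPf (rooted_acyclic rf vt)) /= andbF.
Qed.

(** Both lengths are sums over subsets of W, so the two paths use the same elements and hence the
    same arcs. The arc of f at v is thus an arc (u, g u), and its tail is u = v. *)
Lemma lo_dist_inj f g v : intree f -> intree g -> v != t ->
  meval (pd f v) (lo_point G) = meval (pd g v) (lo_point G) -> f v = g v.
Proof.
move=> itf itg vt; rewrite !meval_pd_lo //.
pose A (h : {ffun 'I_n -> 'I_n}) := [set widx (u, h u) | u in pathset h v].
have arcA h u : intree h -> u \in pathset h v -> (u, h u) \in arcs G.
  by move=> [_ ah]; rewrite !inE /= => /andP[_]; exact: ah.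
have E h : intree h -> \sum_(u in pathset h v) Wval G (widx (u, h u)) = \sum_(j in A h) Wval G j.
  move=> ith; rewrite big_imset // => u u' up up' /= /widx_inj.
  by rewrite !arcA // => /(_ isT isT) [].
have AW h : intree h -> A h \subset Wdom G.
  by move=> ith; apply/fintype.subsetP => j /imsetP [u up ->]; exact/widx_Wdom/arcA.
rewrite !E // => sumE.
have AE : A f = A g by apply: contrapT => ne; case: gen => _ /(_ _ _ (AW _ itf) (AW _ itg) ne).
have vpf h : v \in pathset h v by rewrite inE connect0.
have : widx (v, f v) \in A g by rewrite -AE; apply/imsetP; exists v.
move=> /imsetP [u up /widx_inj]; rewrite !arcA // => /(_ isT isT) [-> ->].
by [].
Qed.

(** If a detour were strictly better on the box, tightness would force equality at the interior
    point z, and the two forms would coincide. *)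
Lemma tight_interior_spt f z : intree f -> interior_point G z -> tight f z -> spt f.
Proof.
move=> itf iz tf; split=> // v w vw [le nle]; apply: nle.
have fz := interior_point_feasible iz.
have e : meval (wmono (D G v w) + pd f w) z = meval (pd f v) z.
  by apply/le_anti; rewrite le //= mevalD tf.
by move=> y _; rewrite (mle_interior_eq sep le iz e).
Qed.

Lemma tight_lo_spt f : intree f -> tight f (lo_point G) -> spt f.
Proof.
move=> itf tf; split=> // v w vw [le nle]; apply: nle.
have fl := feasible_lo_point sep.
have := le _ fl; rewrite mevalD => h.
have e := le_anti (introT andP (conj h (tf _ _ vw))).
have [vt wv] := le_arc_not_connect fl itf vw h.
have [itf' _ pv] := pivot_intree itf vt vw wv.
have fvw : f v = w.
  have := lo_dist_inj itf' itf vt; rewrite pv mevalD e ffunE eqxx => /(_ erefl) ->.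
  by [].
by move=> y _; rewrite pd_step ?fvw //; case: itf.
Qed.

Lemma tight_lo_unique f g : intree f -> intree g ->
  tight f (lo_point G) -> tight g (lo_point G) -> f = g.
Proof.
move=> itf itg tf tg; apply/ffunP => v; have [->|vt] := eqVneq v t.
  by case: itf => -[-> _] _; case: itg => -[-> _] _.
by apply: lo_dist_inj => //; exact: tight_eq.
Qed.

Definition incomparable f v w :=
  ~ mle G (pd f v) (wmono (D G v w) + pd f w) /\ ~ mle G (wmono (D G v w) + pd f w) (pd f v).

(** In the two excluded cases the lengths are comparable: for v = t the left side is 0, and for w
    below v already p_v <= p_w on the box. *)
Lemma incomparable_pivot f v w : intree f -> is_arc G v w -> incomparable f v w ->
  [/\ v != t, ~~ fconnect f w v & intree (upd f v w)].
Proof.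
move=> itf vw [h _].
suff [vt wv] : v != t /\ ~~ fconnect f w v by have [] := pivot_intree itf vt vw wv.
split; apply/negP => e; apply: h => z fz; rewrite mevalD.
  rewrite (eqP e) pd_root ?meval0; last by case: itf => -[].
  by rewrite -(eqP e) addr_ge0 // ?pd_ge0 // ltW // wmono_gt0.
have := pd_connect fz itf e; have := wmono_gt0 fz vw; lra.
Qed.

(** Comparable forms that agree at an interior point agree everywhere, in particular at the lower
    corner, where distinct outgoing arcs of v give distinct lengths. *)
Lemma tight_swap_incomparable f v w z : intree f -> interior_point G z -> is_arc G v w ->
  meval (wmono (D G v w)) z + meval (pd f w) z = meval (pd f v) z -> f v != w ->
  incomparable f v w.
Proof.
move=> itf iz vw e fvw; have fz := interior_point_feasible iz.
have [vt wv] : v != t /\ ~~ fconnect f w v.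
  by apply: (le_arc_not_connect fz) => //; rewrite e.
have [itf' _ pv] := pivot_intree itf vt vw wv.
have E y : meval (pd f v) y = meval (wmono (D G v w) + pd f w) y -> y = lo_point G -> False.
  move=> ey yl; have := lo_dist_inj itf' itf vt; rewrite pv ffunE eqxx -yl ey => /(_ erefl).
  by move=> wE; rewrite wE eqxx in fvw.
split=> le; apply: (E (lo_point G)) => //.
  by apply: mle_interior_eq le iz _ _; rewrite ?mevalD.
by apply/esym; apply: mle_interior_eq le iz _ _; rewrite ?mevalD.
Qed.

End Trees.
(** * Counting shortest-path trees *)

Lemma card_imset_le (aT rT : finType) (A : {set aT}) (B : {pred rT}) (h : aT -> rT) :
  {in A &, injective h} -> {in A, forall x, h x \in B} -> (#|A| <= #|B|)%N.
Proof.
move=> hi hB; rewrite -(card_in_imset hi).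
by apply: subset_leq_card; apply/fintype.subsetP => _ /imsetP [x xA ->]; exact: hB.
Qed.

(** * Pruefer codes of rooted trees *)

Section Pruefer.
Variables (n : nat) (t : 'I_n).
Implicit Types (f g : {ffun 'I_n -> 'I_n}) (S : {set 'I_n}).

Definition leaves f S := (S :\ t) :\: f @: (S :\ t).

(* The last of the #|S| - 1 letters, which is always t, is kept. *)
Fixpoint pruefer m f S : seq 'I_n :=
  if m is m'.+1 then
    if [pick l in leaves f S] is Some l then f l :: pruefer m' f (S :\ l) else [::]
  else [::].

Definition parent_closed f S := t \in S /\ {in S :\ t, forall x, f x \in S}.

(** Without leaves, f would map S minus t onto itself by cardinality, and no iterate would ever
    reach t. *)
Lemma exists_leaf f S : rooted t f -> parent_closed f S -> (1 < #|S|)%N ->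
  exists l, l \in leaves f S.
Proof.
move=> rf [tS cS] S1; apply/set0Pn; apply/negP; rewrite setD_eq0 => sub.
have : S :\ t = f @: (S :\ t).
  by apply/eqP; rewrite eqEcard sub leq_imset_card.
move=> e; have /card_gt0P [x xS] : (0 < #|S :\ t|)%N.
  by move: S1; rewrite (cardsD1 t) tS.
have it j : iter j f x \in S :\ t by elim: j => //= j IH; rewrite e imset_f.
by have [_ /(_ x) [j xj]] := rf; have := it j; rewrite xj !inE eqxx.
Qed.

Lemma parent_closedD1 f S l : parent_closed f S -> l \in leaves f S ->
  parent_closed f (S :\ l).
Proof.
move=> [tS cS]; rewrite !inE => /and3P[lf lt lS]; split; first by rewrite !inE eq_sym lt.
move=> x; rewrite !inE => /and3P[xt xl xS]; rewrite cS ?inE ?xt // andbT.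
by apply: contra lf => /eqP <-; rewrite imset_f // !inE xt.
Qed.

Lemma pruefer_step m f S : rooted t f -> parent_closed f S -> #|S| = m.+2 ->
  exists l, [/\ [pick l in leaves f S] = Some l, l \in leaves f S,
    parent_closed f (S :\ l), #|S :\ l| = m.+1
    & pruefer m.+1 f S = f l :: pruefer m f (S :\ l)].
Proof.
move=> rf cf Sm; have [l0 l0f] : exists l, l \in leaves f S by apply: exists_leaf; rewrite ?Sm.
rewrite /=; case: pickP => [l lf|/(_ l0)]; last by rewrite l0f.
exists l; split=> //; first exact: parent_closedD1.
move: lf; rewrite !inE => /and3P[_ _ lS].
by move: Sm; rewrite (cardsD1 l) lS => -[].
Qed.

Lemma size_pruefer m f S : rooted t f -> parent_closed f S -> #|S| = m.+1 ->
  size (pruefer m f S) = m.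
Proof.
move=> rf; elim: m S => // m IH S cf Sm.
by have [l [_ _ cl Sl ->]] := pruefer_step rf cf Sm; rewrite /= IH.
Qed.

(** The letters are exactly the parents in the remaining tree; this lets the code alone determine
    its leaves. *)
Lemma mem_pruefer m f S : rooted t f -> parent_closed f S -> #|S| = m.+1 ->
  pruefer m f S =i f @: (S :\ t).
Proof.
move=> rf; elim: m S => [|m IH] S cf Sm y.
  rewrite [pruefer 0 f S]/= in_nil; apply/esym/negbTE/imsetP => -[x].
  have [tS _] := cf; move: Sm; rewrite (cardsD1 t) tS => -[] /eqP.
  by rewrite cards_eq0 => /eqP ->; rewrite inE.
have [l [_ + cl Sl ->]] := pruefer_step rf cf Sm; rewrite in_cons IH // !inE => /and3P[_ lt lS].
apply/orP/imsetP => [[/eqP ->|/imsetP [x xS ->]]|[x xS ->]].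
- by exists l; rewrite // !inE lt.
- by exists x => //; move: xS; rewrite !inE => /and3P[-> _ ->].
- have [->|xl] := eqVneq x l; [by left | right; apply/imsetP; exists x => //].
  by move: xS; rewrite !inE xl.
Qed.

Lemma last_pruefer m f S : rooted t f -> parent_closed f S -> #|S| = m.+2 ->
  last t (pruefer m.+1 f S) = t.
Proof.
move=> rf; elim: m S => [|m IH] S cf Sm.
  have [l [_ lf [tl _] Sl ->]] := pruefer_step rf cf Sm.
  move: (lf); rewrite !inE => /and3P[nf lt lS] /=.
  have [_ /(_ l)] := cf; rewrite !inE lt lS => /(_ isT) flS.
  apply/eqP; move: Sl; rewrite (cardsD1 t) tl => -[] /eqP.
  rewrite cards_eq0 => /eqP /setP /(_ (f l)).
  rewrite !inE flS andbT; case: eqP => //= _ /negbFE /eqP fl.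
  (* Here [f l = l], which is excluded since a leaf is nobody's parent. *)
  by move: nf; rewrite -[X in X \notin _]fl imset_f // !inE lt.
have [l [_ _ cl Sl ->]] := pruefer_step rf cf Sm.
have := size_pruefer rf cl Sl; have := IH _ cl Sl.
by case: (pruefer _ _ _).
Qed.

(** Equal codes have the same letters, hence the two trees have the same leaves and [pick] removes
    the same one; the first letter is its parent. *)
Lemma pruefer_inj m f g S : rooted t f -> rooted t g ->
  parent_closed f S -> parent_closed g S -> #|S| = m.+1 ->
  pruefer m f S = pruefer m g S -> {in S, f =1 g}.
Proof.
move=> rf rg; elim: m S => [|m IH] S cf cg Sm pE x xS.
  have [tS _] := cf; move: Sm; rewrite (cardsD1 t) tS => -[] /eqP.
  rewrite cards_eq0 => /eqP /setP /(_ x); rewrite !inE xS andbT => /negbFE /eqP ->.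
  by case: rf => -> _; case: rg => -> _.
have iE : f @: (S :\ t) = g @: (S :\ t).
  by apply/setP => y; rewrite -(mem_pruefer rf cf Sm) pE mem_pruefer.
have [l [lf _ clf Sl pf]] := pruefer_step rf cf Sm.
have [l' [lg _ clg _ pg]] := pruefer_step rg cg Sm.
have : Some l = Some l' by rewrite -lf -lg /leaves iE.
case=> ll; subst l'; move: pE; rewrite pf pg => -[fl tE].
by have [->//|xl] := eqVneq x l; apply: (IH (S :\ l)) => //; rewrite !inE xl.
Qed.

Lemma card_rooted (A : {set {ffun 'I_n -> 'I_n}}) : {in A, forall f, rooted t f} ->
  (#|A| <= n ^ (n - 2))%N.
Proof.
move=> rA.
have [m nE] : exists m, n = m.+1 by exists n.-1; rewrite prednK // (leq_ltn_trans _ (ltn_ord t)).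
have cT f : parent_closed f [set: 'I_n] by split=> [|x _]; rewrite inE.
have Tm : #|[set: 'I_n]| = m.+1 by rewrite cardsT card_ord.
(* The first n - 2 letters of the code; for n = 1 both the code and this function are empty. *)
pose h f := [ffun i : 'I_(n - 2) => nth t (pruefer m f [set: 'I_n]) i].
have -> : (n ^ (n - 2) = #|{: {ffun 'I_(n - 2) -> 'I_n}}|)%N by rewrite card_ffun !card_ord.
apply: (@card_imset_le _ _ A _ h) => // f g /rA rf /rA rg hE.
apply/ffunP => x; apply: (pruefer_inj rf rg (cT f) (cT g) Tm); last by rewrite inE.
have szf := size_pruefer rf (cT f) Tm; have szg := size_pruefer rg (cT g) Tm.
apply: (@eq_from_nth _ t); rewrite szf // => i im.
have [i2|] := ltnP i (n - 2).
  by have /ffunP /(_ (Ordinal i2)) := hE; rewrite !ffunE.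
(* The only position left is the last one, whose letter is t in both codes. *)
move=> im2.
have [m' mE] : exists m', m = m'.+1 by exists m.-1; lia.
have iE : i = m.-1 by lia.
have Tm' : #|[set: 'I_n]| = m'.+2 by rewrite Tm mE.
have := last_pruefer rf (cT f) Tm'; have := last_pruefer rg (cT g) Tm'.
by rewrite -mE !(last_nth t) szf szg mE /= iE mE /= => -> ->.
Qed.

End Pruefer.

(** * The bounds by trees, arcs and variable arcs *)

Section Counting.
Variables (R : realType) (n k : nat) (G : network R n k) (t : 'I_n).
Implicit Types (f g : {ffun 'I_n -> 'I_n}) (u v w : 'I_n) (X : {set 'I_n}).
Hypotheses (sep : separated_variables G) (gen : generic G).

Lemma card_spts_bin : (#|spts G t| <= 'C(#|arcs G|, n - 1))%N.
Proof.
rewrite -cards_draws; apply: (@card_imset_le _ _ _ _ (arcset t)).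
  by move=> f g /spts_root ? /spts_root ?; exact: arcset_inj.
move=> f /sptsP [itf _]; rewrite inE; have [-> _ _ _] := spanning_tree_arcset itf.
by rewrite card_arcset /=.
Qed.

Lemma card_spts_cayley : (#|spts G t| <= n ^ (n - 2))%N.
Proof. by apply: (@card_rooted _ t) => f /sptsP [[rf _] _]. Qed.

Definition is_var (x : weight R k) : bool := if x is Var _ then true else false.

Definition stops f : {set 'I_n} := t |: [set v | (v != t) && is_var (D G v (f v))].

Definition tree_vars f : {set 'I_k} :=
  [set i | [exists v, (v != t) && if D G v (f v) is Var j then j == i else false]].

(** Freezing f on X makes the n-th iterate the first node of X on the path, without searching for
    it. *)
Definition to_stop (X : {set 'I_n}) f v := if v \in X then v else f v.

Definition stop (X : {set 'I_n}) f v := iter n (to_stop X f) v.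

Lemma stop_in X f v : v \in X -> stop X f v = v.
Proof. by move=> vX; apply: iter_fix; rewrite /to_stop vX. Qed.

Lemma stop_mem X f v : rooted t f -> t \in X -> stop X f v \in X.
Proof.
move=> rf tX; apply/negPn/negP => nX.
have E j : iter j (to_stop X f) v \notin X -> iter j (to_stop X f) v = iter j f v.
  elim: j => //= j IH; rewrite /to_stop; case: ifP => [->//|/negbT nXj _].
  by rewrite -IH.
by move: (nX); rewrite /stop E // (rooted_iter_max _ rf) ?tX.
Qed.

Lemma stop_step X f v : rooted t f -> t \in X -> v \notin X ->
  stop X f v = stop X f (f v).
Proof.
move=> rf tX vX; have := stop_mem v rf tX; rewrite /stop => sX.
have -> : f v = to_stop X f v by rewrite /to_stop (negPf vX).
by rewrite -iterSr /= {2}/to_stop sX.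
Qed.

Lemma root_stops f : t \in stops f.
Proof. by rewrite !inE eqxx. Qed.

(** All arcs between v and its first stop are constant, so the length of this piece is the
    difference of the constant coefficients. *)
Definition stop_cost f v : R := (pd G t f v).1 - (pd G t f (stop (stops f) f v)).1.

Lemma const_step f v : intree G t f -> v \notin stops f ->
  exists c, [/\ D G v (f v) = Const c,
    pd G t f v = wmono (Const c) + pd G t f (f v)
    & stop_cost f v = c + stop_cost f (f v)].
Proof.
move=> [rf af]; rewrite !inE negb_or => /andP[vt]; rewrite vt /= => nv.
have := af v vt; rewrite /is_arc; case E: (D G v (f v)) nv => [|c|] //= _ _; exists c.
have pE : pd G t f v = wmono (Const c) + pd G t f (f v) by rewrite pd_step // E.
split=> //; rewrite /stop_cost (@stop_step _ _ v) ?root_stops // ?pE /= ?addrA //.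
by rewrite !inE negb_or vt /= E.
Qed.

Lemma pd_stop f v z : intree G t f ->
  meval (pd G t f v) z = stop_cost f v + meval (pd G t f (stop (stops f) f v)) z.
Proof.
move=> itf; have [rf af] := itf; elim/(@rooted_ind _ t f): v => //.
  by rewrite /stop_cost stop_in ?root_stops // subrr add0r.
move=> v vt IH; have [vX|vX] := boolP (v \in stops f).
  by rewrite /stop_cost stop_in // subrr add0r.
have [c [_ -> ->]] := const_step itf vX; rewrite mevalD IH addrA.
rewrite (@stop_step _ _ v) ?root_stops //; congr (_ + _ + _).
by rewrite /meval /= big1 ?addr0 // => i _; rewrite ffunE mulr0n.
Qed.

(** With a common stop the two forms differ by a constant. Were it negative, the detour would be
    strictly better on the whole box. *)
Lemma stop_cost_le f u w c : spt G t f -> D G u w = Const c ->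
  stop (stops f) f u = stop (stops f) f w -> stop_cost f u <= c + stop_cost f w.
Proof.
move=> [itf sf] uw suw; rewrite leNgt; apply/negP => lt.
have E z : meval (wmono (D G u w) + pd G t f w) z - meval (pd G t f u) z =
    c + stop_cost f w - stop_cost f u.
  rewrite mevalD (pd_stop u) // (pd_stop w) // suw uw /meval /=.
  rewrite [X in c + X]big1; last by move=> i _; rewrite ffunE mulr0n.
  by ring.
apply: (sf u w); first by rewrite /is_arc uw.
split=> [z _|/(_ _ (feasible_lo_point sep))].
  by rewrite -subr_le0 E; lra.
by rewrite -subr_ge0 E; lra.
Qed.

Lemma stop_cost_le_tree f g v : spt G t f -> spt G t g -> stops f = stops g ->
  (forall u, stop (stops f) f u = stop (stops f) g u) -> stop_cost f v <= stop_cost g v.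
Proof.
move=> sf [itg _] sfg s_eq; elim/(@rooted_ind _ t g): v => //; first by case: itg.
  by rewrite /stop_cost !stop_in ?root_stops // !subrr.
move=> v vt IH; have [vX|vX] := boolP (v \in stops g).
  by rewrite /stop_cost !stop_in ?sfg // !subrr.
have [c [cE _ ->]] := const_step itg vX.
apply: le_trans (stop_cost_le sf cE _) _; last by rewrite lerD2l.
by rewrite !s_eq sfg (@stop_step _ _ v) ?root_stops //; case: itg.
Qed.

(* The constant parts of the paths up to the first stop are shortest paths among
   the nodes with that stop, which genericity makes unique. *)
Lemma spt_stop_inj f g : spt G t f -> spt G t g -> stops f = stops g ->
  (forall u, stop (stops f) f u = stop (stops f) g u) ->
  {in stops f, f =1 g} -> f = g.
Proof.
move=> sf sg sfg s_eq fgX; have [itf _] := sf; have [itg _] := sg.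
have cE v : stop_cost f v = stop_cost g v.
  apply/le_anti; rewrite !stop_cost_le_tree // => u; by rewrite -sfg s_eq.
have [rf af] := itf; have [rg ag] := itg.
(* Equality at the lower corner passes from a stop to the nodes it serves by equal stop costs, and
   from stop to stop along the common variable arcs; [lo_dist_inj] then yields equal parents. *)
pose P v := meval (pd G t f v) (lo_point G) = meval (pd G t g v) (lo_point G).
have PS v : P (stop (stops f) f v) -> P v.
  by move=> h; rewrite /P (pd_stop v) // [RHS](pd_stop v) // cE -sfg -s_eq h.
have PX v : P (stop (stops f) f v).
  elim/(@rooted_ind _ t f): v => //.
    by rewrite stop_in ?root_stops // /P !pd_root //; [case: rg | case: rf].
  move=> v vt IH; have [vX|vX] := boolP (v \in stops f); last first.
    by rewrite (@stop_step _ _ v) ?root_stops.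
  rewrite stop_in // /P pd_step // [in RHS]pd_step // -fgX // !mevalD.
  by congr (_ + _); exact: PS.
apply/ffunP => v; have [->|vt] := eqVneq v t; first by case: rf => ->; case: rg => ->.
by apply: (lo_dist_inj sep gen itf itg vt); exact: PS.
Qed.

Lemma mem_tree_vars f i v : v != t -> D G v (f v) = Var i -> i \in tree_vars f.
Proof. by move=> vt E; rewrite inE; apply/existsP; exists v; rewrite vt E eqxx. Qed.

Lemma tree_varsP f i : i \in tree_vars f -> exists2 v, v != t & D G v (f v) = Var i.
Proof.
rewrite inE => /existsP [v /andP[vt]]; case E: (D G v (f v)) => [||j] // /eqP ji.
by exists v; rewrite // E ji.
Qed.

(** A variable labels only one arc, so the set of variables of a tree determines its variable
    arcs. *)
Lemma tree_vars_stops f g v : tree_vars f = tree_vars g -> v \in stops f -> v != t ->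
  (v \in stops g) && (f v == g v).
Proof.
move=> fg + vt; rewrite !inE vt (negPf vt) /=.
case E: (D G v (f v)) => [||i] // _.
have : i \in tree_vars g by rewrite -fg (mem_tree_vars vt E).
move=> /tree_varsP [u ut Eu]; have [_ _ /(_ i) [a [_ h]]] := sep.
have [uv gf] : (u, g u) = (v, f v) by rewrite -(h (u, g u)) // -(h (v, f v)).
by move: Eu gf; rewrite uv => -> ->; rewrite eqxx.
Qed.

Lemma tree_vars_stopsE f g : tree_vars f = tree_vars g -> stops f = stops g.
Proof.
move=> fg; apply/setP => v; have [->|vt] := eqVneq v t; first by rewrite !root_stops.
apply/idP/idP => vs; first by case/andP: (tree_vars_stops fg vs vt).
by case/andP: (tree_vars_stops (esym fg) vs vt).
Qed.

Lemma card_stops f : #|stops f| = #|tree_vars f|.+1.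
Proof.
rewrite cardsU1 inE eqxx add1n; congr _.+1.
pose h v := if D G v (f v) is Var i then Some i else None.
have hi : {in [set v | (v != t) && is_var (D G v (f v))] &, injective h}.
  move=> u v; rewrite !inE /h => /andP[ut] + /andP[vt].
  case E: (D G u (f u)) => [||i] // _; case E': (D G v (f v)) => [||i'] // _ [ii].
  rewrite -ii in E'; have [_ _ /(_ i) [a [_ hu]]] := sep.
  by have [->] : (u, f u) = (v, f v) by rewrite -(hu (u, f u)) // -(hu (v, f v)).
rewrite -(card_in_imset hi) -(card_imset (mem (tree_vars f)) (@Some_inj _)).
apply: eq_card => o; apply/imsetP/imsetP => -[].
  move=> v; rewrite inE /h => /andP[vt]; case E: (D G v (f v)) => [||i] // _ ->.
  by exists i => //; exact: mem_tree_vars E.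
move=> i /tree_varsP [v vt E] ->; exists v; last by rewrite /h E.
by rewrite inE vt E.
Qed.

(** The terms of [Phi] with i >= n have a negative exponent but are nonnegative. No tree contributes
    to them, since i variables require i + 1 stops among n nodes, so 0 is a safe lower bound. *)
Definition Phi_term i : nat := if (i < n)%N then (i.+1 ^ (n - i.+1))%N else 0%N.

(** The variable set fixes the |I| + 1 stops; each of the remaining n - |I| - 1 nodes chooses one of
    them, and these choices determine the tree. *)
Lemma card_spts_vars (I : {set 'I_k}) :
  (#|[set f in spts G t | tree_vars f == I]| <= Phi_term #|I|)%N.
Proof.
have [->|[f0]] := set_0Vmem [set f in spts G t | tree_vars f == I]; first by rewrite cards0.
rewrite !inE => /andP[_ /eqP I0]; set X := stops f0.
have Xn : #|X| = #|I|.+1 by rewrite card_stops I0.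
have In : (#|I| < n)%N by rewrite -Xn -[leqRHS]card_ord max_card.
have -> : Phi_term #|I| = #|pffun_on t (mem (~: X)) (mem X)|.
  by rewrite /Phi_term In card_pffun_on Xn [#|mem (~: X)|]cardsCs setCK Xn card_ord.
(* On X the value is the default t that [pffun_on] prescribes outside the domain. *)
pose h f := [ffun v => if v \in X then t else stop X f v].
have sX f : f \in [set f in spts G t | tree_vars f == I] -> stops f = X.
  by rewrite !inE => /andP[_ /eqP fI]; apply: tree_vars_stopsE; rewrite fI I0.
have sp f : f \in [set f in spts G t | tree_vars f == I] -> spt G t f.
  by rewrite inE => /andP[/sptsP].
apply: (@card_imset_le _ _ _ _ h) => [f g fA gA hE|f fA].
  apply: spt_stop_inj; rewrite ?(sX f) ?(sX g) //; try exact: sp.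
    move=> u; have [uX|/negPf uX] := boolP (u \in X); first by rewrite !stop_in.
    by have /ffunP /(_ u) := hE; rewrite !ffunE uX.
  move=> v vX; have [->|vt] := eqVneq v t.
    by have [[[-> _] _] _] := sp f fA; have [[[-> _] _] _] := sp g gA.
  have fg : tree_vars f = tree_vars g.
    by move: fA gA; rewrite !inE => /andP[_ /eqP ->] /andP[_ /eqP ->].
  by rewrite -(sX f) // in vX; have /andP[_ /eqP] := tree_vars_stops fg vX vt.
apply/pffun_onP; split.
  apply/supportP => v; rewrite ffunE; case: ifPn => // nX /negP [].
  by rewrite -in_setC in nX.
move=> _ /imageP [v vX ->]; rewrite ffunE ifN; last by rewrite -in_setC.
by apply: stop_mem; rewrite ?root_stops //; have [[]] := sp f fA.
Qed.

Lemma card_spts_Phi : ((#|spts G t|)%:R : rat) <= Phi n k.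
Proof.
have : (#|spts G t| <= \sum_(i < k.+1) 'C(k, i) * Phi_term i)%N.
  rewrite -sum1_card (partition_big tree_vars xpredT) //=.
  apply: leq_trans (_ : _ <= \sum_(I : {set 'I_k}) Phi_term #|I|)%N _.
    by apply: leq_sum => I _; rewrite sum1dep_card; exact: card_spts_vars.
  rewrite (partition_big (fun I : {set 'I_k} => inord #|I| : 'I_k.+1) xpredT) //=.
  apply: leq_sum => i _.
  have cI (I : {set 'I_k}) : (inord #|I| == i) = (#|I| == i).
    rewrite -val_eqE /= inordK // ltnS -[leqRHS]card_ord; exact: max_card.
  rewrite (eq_bigr (fun=> Phi_term i)); last by move=> I; rewrite cI => /eqP ->.
  have := card_draws 'I_k i; rewrite card_ord => <-; rewrite sum_nat_const leq_mul2r.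
  by apply/orP; right; apply: eq_leq; apply: eq_card => I; rewrite !inE; exact: cI.
rewrite -(ler_nat rat) => /le_trans; apply; rewrite natr_sum /Phi.
apply: ler_sum => i _; rewrite natrM ler_wpM2l ?ler0n // /Phi_term.
case: ltnP => ni; last by rewrite exprz_ge0 // ler0n.
have -> : n%:Z - i%:Z - 1 = (n - i.+1)%N%:Z by lia.
by rewrite natrX.
Qed.

End Counting.
(** * Connectivity *)

Section TopologicalLemmas.

(** A finite Baire argument: if U is not contained in [F i], then U minus [F i] is open, nonempty
    and covered by the other sets. *)
Lemma exists_open_piece (T : topologicalType) (I : eqType) (s : seq I)
    (F : I -> set T) (U : set T) :
  (forall i, closed (F i)) -> open U -> (U !=set0)%classic ->
  (forall x, U x -> exists2 i, i \in s & F i x) ->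
  exists i (V : set T), [/\ open V, V !=set0, V `<=` U & V `<=` F i]%classic.
Proof.
move=> cF; elim: s U => [|i s IH] U oU [x Ux] UF; first by have [] := UF x Ux.
have [UFi|] := pselect (U `<=` F i)%classic; first by exists i, U; split=> //; exists x.
move=> /existsNP [y /not_implyP [Uy nFy]].
have [||z [Uz nFz]|j [V [oV V0 VU VF]]] := IH (U `&` ~` F i)%classic.
- by apply: openI => //; exact: closed_openC.
- by exists y.
- have [j] := UF z Uz; rewrite inE => /orP[/eqP ->//|js Fz]; by exists j.
by exists j, V; split=> // z /VU [].
Qed.

Variables (R : realType) (k : nat).
Implicit Types (z : 'rV[R]_k) (f : monomial R k).

Lemma interior_ball (S : set 'rV[R]_k) z : interior S z ->
  exists2 e : R, 0 < e & forall y : 'rV[R]_k, (forall i, `|z 0 i - y 0 i| < e) -> S y.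
Proof.
move=> /nbhs_ballP [e /= e0 h]; exists e => // y zy; apply: h.
by split=> // i j; rewrite ord1; exact: zy.
Qed.

Lemma meval_continuous f : continuous (meval f).
Proof.
have cX i m : continuous (fun z : 'rV[R]_k => z 0 i *+ m).
  elim: m => [|m IH] z.
    have -> : (fun z : 'rV[R]_k => z 0 i *+ 0) = (fun=> 0).
      by apply/funext => y; rewrite mulr0n.
    exact: cst_continuous.
  have -> : (fun z : 'rV[R]_k => z 0 i *+ m.+1) = (fun z => z 0 i + z 0 i *+ m).
    by apply/funext => y; rewrite mulrS.
  by apply: (cvgD (@coord_continuous _ _ _ _ _ z) (IH z)).
have cS : continuous (fun z : 'rV[R]_k => \sum_i z 0 i *+ f.2 i).
  by apply: continuous_big => //; exact: add_continuous.
by move=> z; apply: (cvgD (cvg_cst f.1) (cS z)).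
Qed.

(** Both sides are affine on the line through z and y, and they agree at z and at a second point of
    that line inside the ball. *)
Lemma affine_eq_ball f (c : R) (a : 'rV[R]_k) z (e : R) : 0 < e ->
  (forall y : 'rV[R]_k, (forall i, `|z 0 i - y 0 i| < e) -> meval f y = c + \sum_i a 0 i * y 0 i) ->
  forall y, meval f y = c + \sum_i a 0 i * y 0 i.
Proof.
move=> e0 h y; pose N := 1 + \sum_i `|y 0 i - z 0 i|.
have N1 : 1 <= N by rewrite lerDl sumr_ge0.
(* N bounds every coordinate difference of y and z, so a step s moves no coordinate by more than e /
   2; the summand 1 keeps N positive. *)
pose s := e / (2 * N); have s0 : 0 < s by rewrite divr_gt0 // mulr_gt0 //; lra.
have hz : meval f z = c + \sum_i a 0 i * z 0 i.
  by apply: h => i; rewrite subrr normr0.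
have : meval f (z + s *: (y - z)) = c + \sum_i a 0 i * (z + s *: (y - z)) 0 i.
  apply: h => i; rewrite !mxE opprD addrA subrr add0r normrN normrM gtr0_norm //.
  have yN : `|y 0 i - z 0 i| <= N.
    by rewrite /N (bigD1 i) //= addrCA lerDl addr_ge0 // sumr_ge0.
  have : s * N = e / 2 by rewrite /s; field; lra.
  by have := ler_wpM2l (ltW s0) yN; lra.
rewrite meval_segment hz.
have -> : \sum_i a 0 i * (z + s *: (y - z)) 0 i =
   \sum_i a 0 i * z 0 i + s * (\sum_i a 0 i * y 0 i - \sum_i a 0 i * z 0 i).
  rewrite -sumrB mulr_sumr -big_split /=; apply: eq_bigr => i _; rewrite !mxE; ring.
move=> E; have : s * (meval f y - (c + \sum_i a 0 i * y 0 i)) = 0.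
  by move: E; lra.
by move/eqP; rewrite mulf_eq0 gt_eqF //= subr_eq0 => /eqP.
Qed.

End TopologicalLemmas.

(** * Exchanges of arcs, and moving along a segment *)

Section Cells.
Variables (R : realType) (n k : nat) (G : network R n k) (t : 'I_n).
Implicit Types (f g : {ffun 'I_n -> 'I_n}) (u v w : 'I_n) (z : 'rV[R]_k).
Hypotheses (sep : separated_variables G) (gen : generic G).

(** Stated along a map h so as to serve both for the parameter of a segment and, with h the
    identity, for the whole space. *)
Lemma closed_tight (T : topologicalType) (h : T -> 'rV[R]_k) f :
  (forall g : monomial R k, continuous (fun s => meval g (h s))) ->
  closed [set s | tight G t f (h s)]%classic.
Proof.
move=> ch.
have -> : [set s | tight G t f (h s)]%classic =
    (\bigcap_(a in [set a | is_arc G a.1 a.2]) ((fun s => meval (wmono (D G a.1 a.2)) (h s) +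
      meval (pd G t f a.2) (h s) - meval (pd G t f a.1) (h s)) @^-1` [set x | 0 <= x]))%classic.
  apply/seteqP; split=> s /= hs.
    by move=> [v w] /= vw; rewrite subr_ge0; exact: hs.
  by move=> v w vw; rewrite -subr_ge0; exact: (hs (v, w) vw).
apply: closed_bigI => a _; apply: preimage_closed; last exact: closed_ge.
by move=> s _; apply: (cvgB (cvgD (ch _ s) (ch _ s)) (ch _ s)).
Qed.

(** Moving one coordinate by e / 2 either way stays in the cell, hence in the box, so no bound is
    attained at z. *)
Lemma interior_cell_point f z : f t = t -> interior (cell G t (arcset t f)) z ->
  interior_point G z /\ tight G t f z.
Proof.
move=> ft iz; have /(cell_arcset G z ft) [fz tz] := interior_subset iz; split=> //.
move=> i; have [e e0 h] := interior_ball iz.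
have far (d : R) : `|d| < e -> feasible G (set_coord z i (z 0 i + d)).
  move=> de; suff /h /(cell_arcset _ _ ft) [] :
    forall j, `|z 0 j - set_coord z i (z 0 i + d) 0 j| < e by [].
  move=> j; rewrite mxE; case: eqP => [->|_]; last by rewrite subrr normr0.
  by rewrite opprD addrA subrr add0r normrN.
have e2 : `|e / 2| < e by rewrite gtr0_norm; lra.
have [+ _] := far (- (e / 2)) (etrans (congr1 (fun x => x < e) (normrN _)) e2) i.
have [_ +] := far (e / 2) e2 i.
rewrite !mxE eqxx => zu zl; split; first by lra.
by apply: lt_le_trans zu; rewrite lte_fin; lra.
Qed.

(** P stands for having been visited: the closure property is all that is needed of the traversal to
    prove completeness. *)
Definition swap_closed (P : {ffun 'I_n -> 'I_n} -> Prop) := forall f v w, P f ->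
  is_arc G v w -> incomparable G t f v w -> spt G t (upd f v w) -> P (upd f v w).

(* Exchange the arcs in which f and g differ one by one: distances at z do not
   change, so that all the intermediate trees are tight at z. *)
Lemma swap_closed_tight P f g z : swap_closed P -> interior_point G z ->
  intree G t f -> intree G t g -> tight G t f z -> tight G t g z -> P f -> P g.
Proof.
move=> cP iz; have fz := interior_point_feasible iz.
elim: {f}_.+1 {-2}f (ltnSn #|[pred v | f v != g v]|) => // m IH f.
rewrite ltnS => fgm itf itg tf tg Pf.
have [fg|/forallPn [v fgv]] := boolP [forall v, f v == g v].
  by suff <- : f = g by []; apply/ffunP => v; exact/eqP/(forallP fg).
have vt : v != t.
  by apply: contra fgv => /eqP ->; case: itf itg => -[-> _] _ [[-> _] _].
have vw : is_arc G v (g v) by case: itg => _ /(_ v vt).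
have e : meval (wmono (D G v (g v))) z + meval (pd G t f (g v)) z = meval (pd G t f v) z.
  rewrite !(tight_eq _ itf tf itg tg) [in RHS]pd_step ?mevalD //.
  by case: itg.
have [itf' tf'] := pivot_tight sep gen fz itf tf vw e.
apply: (IH (upd f v (g v))) => //; last first.
  apply: cP => //; first exact: (tight_swap_incomparable sep gen itf iz vw e).
  exact: (tight_interior_spt sep itf' iz tf').
apply: leq_trans fgm; apply: proper_card; apply/properP; split.
  apply/fintype.subsetP => u; rewrite !inE ffunE.
  by case: ifP => // /eqP ->; rewrite eqxx.
by exists v; rewrite inE // ffunE eqxx eqxx.
Qed.

Lemma swap_closed_complete P f0 g z : swap_closed P -> P f0 ->
  intree G t f0 -> tight G t f0 (lo_point G) ->
  intree G t g -> interior_point G z -> tight G t g z -> P g.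
Proof.
move=> cP P0 itf0 tf0 itg iz tg.
pose seg (s : R) := lo_point G + s *: (z - lo_point G).
have fl := feasible_lo_point sep.
have seg1 : seg 1 = z by rewrite /seg scale1r addrC subrK.
have seg0 : seg 0 = lo_point G by rewrite /seg scale0r addr0.
have segi (s : R) : 0 < s -> s <= 1 -> interior_point G (seg s).
  exact: interior_point_segment.
have segf (s : R) : 0 <= s -> s <= 1 -> feasible G (seg s).
  rewrite le_eqVlt => /orP[/eqP <- _|s0 s1]; first by rewrite seg0.
  exact: interior_point_feasible (segi _ s0 s1).
have seg_cont (h : monomial R k) : continuous (fun s => meval h (seg s)).
  pose m := meval h (lo_point G); pose d := meval h z - m.
  have -> : (fun s => meval h (seg s)) = (fun s => m + s * d).
    by apply/funext => s; rewrite /seg meval_segment.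
  have cd : continuous (fun s : R => s * d) by exact: mulrr_continuous.
  by move=> s; apply: (cvgD (cvg_cst m) (cd s)).
pose A (Q : {ffun 'I_n -> 'I_n} -> Prop) :=
  (\bigcup_(f in [set f | Q f /\ intree G t f]) [set s | tight G t f (seg s)])%classic.
have closedA Q : closed (A Q).
  apply: closed_bigcup => [|f _]; first exact: finite_finset.
  exact: closed_tight.
(* At s = 0 the point is not interior, and uniqueness of the tight tree at the corner replaces the
   exchange argument. *)
have disj s : `[0, 1]%classic s -> A P s -> A (fun f => ~ P f) s -> False.
  rewrite /= in_itv /= => /andP[+ s1] [f [Pf itf] /= tf] [f' [nPf' itf'] /= tf'].
  rewrite le_eqVlt => /orP[/eqP s0|s0].
    rewrite -s0 seg0 in tf tf'; apply: nPf'.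
    by rewrite (tight_lo_unique sep gen itf' itf tf' tf).
  exact: nPf' (swap_closed_tight cP (segi s s0 s1) itf itf' tf tf' Pf).
have cover s : `[0, 1]%classic s -> A P s \/ A (fun f => ~ P f) s.
  rewrite /= in_itv /= => /andP[s0 s1].
  have [f itf tf] := exists_tight sep gen (segf s s0 s1) itf0.
  have [Pf|nPf] := pselect (P f); [left | right]; by exists f.
(* The visited part is nonempty because of f0, closed, and open in the segment as the complement of
   the closed unvisited part. *)
have E : (`[0, 1] `&` A P = `[0, 1])%classic.
  apply: segment_connected.
  - exists 0; split; first by rewrite /= in_itv /= lexx ler01.
    by exists f0 => //=; rewrite seg0.
  - exists (~` A (fun f => ~ P f))%classic; first exact: closed_openC.
    apply/seteqP; split=> s [s01 h]; split=> //; first by move=> h'; exact: (disj s).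
    by case: (cover s s01).
  - by exists (A P).
have [f [Pf itf] /= tf] : A P 1.
  have : `[0, 1]%classic (1 : R) by rewrite /= in_itv /= lexx ler01.
  by rewrite -[X in X 1 -> _]E => -[].
rewrite seg1 in tf; exact: (swap_closed_tight cP iz itf itg tf tg Pf).
Qed.

End Cells.
(** * Regions *)

Section Regions.
Variables (R : realType) (n k : nat) (G : network R n k) (t : 'I_n).
Implicit Types (f g : {ffun 'I_n -> 'I_n}) (u v w : 'I_n) (z : 'rV[R]_k).
Hypotheses (sep : separated_variables G) (gen : generic G).

Local Notation trop_pow z r := (iter r (trop_mul (map_mx (weval z) (D G))) (trop_one R n)).
Local Notation dist z v := (kleene_star (map_mx (weval z) (D G)) v t).

Lemma weval_arc z v w : is_arc G v w -> weval z (D G v w) = (meval (wmono (D G v w)) z)%:E.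
Proof.
rewrite /is_arc /meval; case: (D G v w) => [|c|i] //= _.
  by rewrite big1 ?addr0 // => i _; rewrite ffunE mulr0n.
rewrite add0r (bigD1 i) //= big1 ?addr0; last first.
  by move=> j /negPf ji; rewrite ffunE ji mulr0n.
by rewrite ffunE eqxx mulr1n.
Qed.

Lemma trop_powS z r v : trop_pow z r.+1 v t =
  \big[Order.min/+oo%E]_(l < n) (weval z (D G v l) + trop_pow z r l t)%E.
Proof. by rewrite iterS mxE; apply: eq_bigr => l _; rewrite mxE. Qed.

Lemma trop_pow_ge0 z r v : feasible G z -> (0 <= trop_pow z r v t)%E.
Proof.
move=> fz; elim: r v => [|r IH] v; first by rewrite mxE; case: ifP => //; rewrite leey.
rewrite trop_powS; apply: le_bigmin => [|l _]; first exact: leey.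
apply: adde_ge0 => //; have [vl|] := boolP (is_arc G v l).
  by rewrite weval_arc // lee_fin ltW // wmono_gt0.
by rewrite /is_arc; case: (D G v l) => //= _; rewrite leey.
Qed.

Lemma trop_pow_connect z r v : feasible G z -> (trop_pow z r v t < +oo)%E ->
  connect (is_arc G) v t.
Proof.
move=> fz; elim: r v => [|r IH] v.
  by rewrite mxE; case: eqP => [->|_] //; rewrite ltxx.
rewrite trop_powS => /bigmin_ltP [|[l _ h]]; first by rewrite ltxx.
have vl : is_arc G v l.
  move: h; rewrite /is_arc; case: (D G v l) => //=.
  by have := trop_pow_ge0 r l fz; case: (trop_pow z r l t).
apply: connect_trans (connect1 vl) _; apply: IH.
by move: h; rewrite weval_arc //; case: (trop_pow z r l t) => [x _||] //; exact: ltry.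
Qed.

Lemma dist_connect z v : feasible G z -> (dist z v < +oo)%E -> connect (is_arc G) v t.
Proof. by move=> fz /ereal_inf_lt [_ [r _ <-]]; exact: trop_pow_connect. Qed.

(** Upper bound: the tree path is one of the walks counted in the power whose exponent is its number
    of arcs. Lower bound: a feasible potential lies below every power, by induction on the
    exponent. *)
Lemma dist_tight f z v : intree G t f -> tight G t f z -> dist z v = (meval (pd G t f v) z)%:E.
Proof.
move=> [[ft rf] af] tf; apply/le_anti/andP; split.
  apply: ge_ereal_inf; suff [r hr] : exists r, (trop_pow z r v t <= (meval (pd G t f v) z)%:E)%E.
    by exists (trop_pow z r v t) => //; exists r.
  elim/(@rooted_ind _ t f): v => //.
    by exists 0%N; rewrite mxE eqxx pd_root // meval0.
  move=> v vt [r hr]; exists r.+1; rewrite trop_powS.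
  apply: (bigmin_inf (f v)) => //; rewrite weval_arc ?af // pd_step // mevalD [leRHS]EFinD.
  by rewrite leeD2l.
apply/ereal_infP => _ [r _ <-]; elim: r v => [|r IH] v.
  by rewrite mxE; case: eqP => [->|_]; rewrite ?leey // pd_root // meval0.
rewrite trop_powS; apply: le_bigmin => [|l _]; first exact: leey.
have [vl|] := boolP (is_arc G v l).
  rewrite weval_arc //; apply: le_trans (leeD2l _ (IH l)).
  by rewrite -EFinD lee_fin tf.
rewrite /is_arc; case: (D G v l) => //= _; have := IH l.
by case: (trop_pow z r l t) => //= [x|] _; rewrite leey.
Qed.

Lemma region_connect S : region G t S -> forall v, connect (is_arc G) v t.
Proof.
move=> [[z /interior_subset Sz] [c [a SE]]] v; move: Sz; rewrite SE => -[fz h].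
by apply: (dist_connect fz); rewrite h ltry.
Qed.

(** On an open piece of S a single tree f is tight, so its distances are the affine functions of the
    region, and then everywhere. At any other point of S a tight tree g has the same values as f,
    which makes f tight there too. *)
Lemma region_cell S f0 : intree G t f0 -> region G t S ->
  exists f z, [/\ intree G t f, interior_point G z, tight G t f z & S = cell G t (arcset t f)].
Proof.
move=> itf0 [S0 [c [a SE]]].
have Sdist z g v : S z -> intree G t g -> tight G t g z ->
    meval (pd G t g v) z = c v + \sum_i a v 0 i * z 0 i.
  rewrite SE => -[fz h] itg tg; have := h v; rewrite (dist_tight v itg tg).
  by move=> [].
(* The condition on g does not involve z; it makes [F g] empty, hence closed, when g is not a
   tree. *)
pose F g := [set z | intree G t g /\ tight G t g z]%classic.
have closedF g : closed (F g).
  have -> : F g = ([set z | intree G t g] `&` [set z | tight G t g z])%classic by [].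
  apply: closedI; last by apply: closed_tight => h; exact: meval_continuous.
  have [itg|nitg] := pselect (intree G t g).
    have -> : [set z : 'rV[R]_k | intree G t g]%classic = classical_sets.setT.
      by apply/seteqP; split.
    exact: closedT.
  have -> : [set z : 'rV[R]_k | intree G t g]%classic = classical_sets.set0.
    by apply/seteqP; split.
  exact: closed0.
have [|||f [V [oV [z Vz] VS VF]]] :=
  @exists_open_piece _ _ (enum {: {ffun 'I_n -> 'I_n}}) F (interior S) closedF.
- exact: open_interior.
- exact: S0.
- move=> z /interior_subset; rewrite SE => -[fz _].
  by have [f ? ?] := exists_tight sep gen fz itf0; exists f => //; rewrite mem_enum.
have [itf tf] := VF z Vz.
have Vi y : V y -> interior V y by move=> Vy; rewrite -(interior_id V).1 in Vy.
have [e e0 he] := interior_ball (Vi z Vz).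
have VinS y : V y -> S y by move=> /VS /interior_subset.
have E v : forall y, meval (pd G t f v) y = c v + \sum_i a v 0 i * y 0 i.
  apply: (affine_eq_ball e0) => y zy; have Vy := he y zy.
  by apply: Sdist; [exact: VinS | exact: itf | have [] := VF y Vy].
have [ft _] := itf.1.
have SC : S = cell G t (arcset t f).
  apply/seteqP; split=> y.
    move=> Sy; apply/cell_arcset => //; have fy : feasible G y by move: Sy; rewrite SE => -[].
    split=> // v w vw; have [g itg tg] := exists_tight sep gen fy itf0.
    by rewrite !E -!(Sdist y g _ Sy itg tg) tg.
  move=> /(cell_arcset G _ ft) [fy ty]; rewrite SE; split=> // v.
  by rewrite (dist_tight v itf ty) E.
exists f, z; split=> //.
have /interior_cell_point [] // : interior (cell G t (arcset t f)) z.
by rewrite -SC; exact: VS.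
Qed.

End Regions.
(** * Cost of the programs *)

(* [wp P c l T Q]: run from l live words after T operations, c never exceeds P
   words and ends with a value, a number of live words and a total number of
   operations that satisfy Q. *)
Definition wp A (P : nat) (c : comp A) (l T : nat) (Q : A -> nat -> nat -> Prop) : Prop :=
  (peak (c l) <= P)%N /\ Q (value (c l)) (live (c l)) (T + time (c l))%N.

Lemma wp_conseq A P (c : comp A) l T (Q Q' : A -> nat -> nat -> Prop) : wp P c l T Q ->
  (forall x l' T', Q x l' T' -> Q' x l' T') -> wp P c l T Q'.
Proof. by move=> [? h] QQ; split=> //; exact: QQ. Qed.

Lemma wp_ret A P (x : A) l T (Q : A -> nat -> nat -> Prop) :
  (l <= P)%N -> Q x l T -> wp P (ret x) l T Q.
Proof. by rewrite /wp /= addn0. Qed.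

Lemma wp_op A P (x : A) l T (Q : A -> nat -> nat -> Prop) :
  (l <= P)%N -> Q x l T.+1 -> wp P (op x) l T Q.
Proof. by rewrite /wp /= addn1. Qed.

Lemma wp_bind A B P (c : comp A) (f : A -> comp B) l T Q :
  wp P c l T (fun x l' T' => wp P (f x) l' T' Q) -> wp P (bind c f) l T Q.
Proof. by move=> [p1 [p2 q]]; rewrite /wp /= geq_max p1 addnA. Qed.

Lemma wp_op_bind A B P (x : A) (f : A -> comp B) l T Q :
  (l <= P)%N -> wp P (f x) l T.+1 Q -> wp P (bind (op x) f) l T Q.
Proof. by move=> lP h; apply: wp_bind; exact: wp_op. Qed.

(** The invariant speaks of the prefix already consumed. The strict inequality asked of the body
    pays for the operation that the loop charges per iteration. *)
Lemma wp_for A B P (s : seq A) (st : B) (f : B -> A -> comp B) l T c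
    (Inv : seq A -> B -> nat -> Prop) Q :
  Inv [::] st l ->
  (forall s1 st l, Inv s1 st l -> (l <= P)%N) ->
  (forall s1 i s2 st l T, s = s1 ++ i :: s2 -> Inv s1 st l ->
    wp P (f st i) l T (fun st' l' T' => Inv (rcons s1 i) st' l' /\ (T' < T + c)%N)) ->
  (forall st l T', Inv s st l -> (T' <= T + size s * c)%N -> Q st l T') ->
  wp P (for_each s st f) l T Q.
Proof.
move=> I0 IP If IQ.
suff loop s2 s1 st' l' T' : s = s1 ++ s2 -> Inv s1 st' l' -> (T' <= T + size s1 * c)%N ->
    wp P (for_each s2 st' f) l' T' Q.
  by apply: (loop s [::]) => //; rewrite addn0.
elim: s2 s1 st' l' T' => [|i s2 IH] s1 st' l' T' sE Is hT /=.
  by apply: wp_ret; [exact: IP Is | apply: IQ; rewrite sE cats0].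
apply: wp_op_bind; first exact: IP Is.
apply: wp_bind; apply: wp_conseq (If _ _ _ _ _ _ sE Is) _ => st2 l2 T2 [I2 hT2].
apply: (IH (rcons s1 i)) => //; first by rewrite cat_rcons.
by rewrite size_rcons mulSn; lia.
Qed.

Lemma wp_alloc_bind B P s (f : unit -> comp B) l T Q :
  (l + s <= P)%N -> wp P (f tt) (l + s)%N (T + s)%N Q -> wp P (bind (alloc s) f) l T Q.
Proof. by move=> lP h; apply: wp_bind; split. Qed.

Lemma wp_free_bind B P s (f : unit -> comp B) l T Q :
  (l <= P)%N -> wp P (f tt) (l - s)%N T.+1 Q -> wp P (bind (free s) f) l T Q.
Proof. by move=> lP h; apply: wp_bind; split; rewrite //= addn1. Qed.

Ltac wp_step := apply: wp_op_bind; [by lia | cbv beta].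

(** * Comparison, distances, test of a tree, list of arcs *)

Section Subroutines.
Variables (R : realType) (n k : nat) (G : network R n k) (t : 'I_n) (P : nat).
Implicit Types (f g : monomial R k) (l T : nat).

Definition compare_time : nat := (4 + k * 9)%N.

Lemma wp_compare f g l T (Q : bool -> nat -> nat -> Prop) :
  separated_variables G -> (l <= P)%N ->
  (forall (b : bool) T', (b <-> mle G f g) -> (T' <= T + compare_time)%N -> Q b l T') ->
  wp P (compare G f g) l T Q.
Proof.
move=> sep lP HQ; rewrite /compare; do 3 wp_step.
apply: wp_bind; apply: (wp_for (c := 9)
    (Inv := fun s1 acc l' => l' = l /\
      acc = ((g.1 - f.1)%:E + \sum_(i <- s1) min_term G f g i)%E)).
- by rewrite big_nil adde0.
- by move=> ? ? ? [-> _].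
- move=> s1 i s2 acc _ T' _ [-> ->].
  have E : \sum_(j <- rcons s1 i) min_term G f g j =
    (\sum_(j <- s1) min_term G f g j + min_term G f g i)%E.
    by rewrite -cats1 big_cat big_seq1.
  do 3 wp_step; case: ifPn => c; do 3 wp_step; apply: wp_op => //; (split; last by lia);
    split=> //; rewrite E addeA /min_term.
    by rewrite c.
  by rewrite (negPf c).
move=> acc _ T' [-> ->]; rewrite size_enum_ord => hT.
apply: wp_op => //; apply: HQ; last by rewrite /compare_time; lia.
exact: box_min_correct.
Qed.

Definition add_time : nat := (7 + k * 5)%N.

Lemma wp_add_weight (x : weight R k) f l T Q : (l + k.+1 <= P)%N ->
  (forall T', (T' <= T + add_time)%N -> Q (wmono x + f) (l + k.+1)%N T') ->
  wp P (add_weight x f) l T Q.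
Proof.
move=> lP HQ; rewrite /add_weight; apply: wp_alloc_bind => //.
wp_step; apply: wp_bind.
set c := (X in wp _ X); apply: (@wp_conseq _ _ c _ _ (fun y l' T' => l' = (l + k.+1)%N /\
   y = (wmono x).1 + f.1 /\ (T' <= T + k.+1 + 2)%N)).
  rewrite /c; case: (x) => [|c1|i]; [apply: wp_ret | apply: wp_op | apply: wp_ret] => //=;
    by rewrite ?add0r; do 2 split=> //; lia.
move=> {c} y _ T1 [-> [yE hT1]].
apply: wp_bind; apply: (wp_for (c := 4)
  (Inv := fun s1 (e : {ffun 'I_k -> nat}) l' => l' = (l + k.+1)%N /\
    forall j, e j = if j \in s1 then f.2 j else 0%N)).
- by split=> // j; rewrite ffunE.
- by move=> ? ? ? [-> _].
- move=> s1 i s2 e _ T2 _ [-> he]; wp_step; apply: wp_op => //; split; last by lia.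
  split=> // j; rewrite ffunE mem_rcons inE he; by case: eqP => [->|].
move=> e _ T2 [-> he]; rewrite size_enum_ord => hT2.
have {}he : e = f.2 by apply/ffunP => j; rewrite he mem_enum.
case: x HQ yE => [|c1|i] HQ yE.
- apply: wp_ret => //; rewrite he yE.
  have -> : ((wmono (@Infty R k)).1 + f.1, f.2) = wmono Infty + f.
    by rewrite [RHS]add0r add0r -surjective_pairing.
  by apply: HQ; rewrite /add_time; lia.
- apply: wp_ret => //; rewrite he yE.
  have -> : ((wmono (@Const R k c1)).1 + f.1, f.2) = wmono (Const c1) + f.
    by congr (_, _); rewrite add0r.
  by apply: HQ; rewrite /add_time; lia.
- do 3 wp_step; apply: wp_ret => //; rewrite he yE.
  have -> : ((wmono (@Var R k i)).1 + f.1, upd f.2 i (f.2 i).+1) = wmono (Var i) + f.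
    congr (_, _); apply/ffunP => j; rewrite !ffunE.
    by case: eqP => [->|].
  by apply: HQ; rewrite /add_time; lia.
Qed.

(* The last clause says that parents precede children. *)
Definition topo (ord : seq 'I_n) (par : {ffun 'I_n -> 'I_n}) : Prop :=
  [/\ uniq ord, forall v, v \in ord, par t = t
    & forall u, u != t -> subseq [:: par u; u] ord].

Lemma topo_split ord par s1 u s2 : topo ord par -> ord = s1 ++ u :: s2 -> u != t ->
  par u \in s1.
Proof.
move=> [uo _ _ h] oE /h; rewrite oE in uo *; move: (par u) uo => x {h oE}.
elim: s1 => [|a s1 IH]; last first.
  by rewrite cat_cons inE [subseq _ _]/= => /andP[_ us1]; case: eqP => //= _; exact: IH.
rewrite [uniq _]/= [subseq _ _]/= => /andP[us _].
by case: (x == u) => /mem_subseq /(_ u); rewrite !inE eqxx ?orbT (negPf us) => /(_ isT).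
Qed.

Lemma size_topo ord par : topo ord par -> size ord = n.
Proof.
move=> [uo ao _ _]; rewrite -[RHS]card_ord -(card_uniqP uo).
by apply: eq_card => v; rewrite ao.
Qed.

(** Parents have smaller positions in [ord], so following them must end, and it can only end at
    t. *)
Lemma topo_rooted ord par : topo ord par -> rooted t par.
Proof.
move=> tp; have [uo ao pt h] := tp; split=> // v.
have [m] := ubnP (index v ord); elim: m v => // m IH v vm.
have [->|vt] := eqVneq v t; first by exists 0%N.
have [s1 [s2 oE]] : exists s1 s2, ord = s1 ++ v :: s2.
  by case/splitPr: (ao v) => s1 s2; exists s1, s2.
have pv := topo_split tp oE vt.
have [|j hj] := IH (par v); last by exists j.+1; rewrite iterSr.
apply: leq_trans (_ : index v ord <= m)%N; last by rewrite -ltnS.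
rewrite oE !index_cat pv ifN; first by rewrite /= eqxx addn0 index_mem.
by move: uo; rewrite oE cat_uniq /= negb_or => /and3P[_ /andP[]].
Qed.

Definition distances_time : nat := (n + n * (k.+1 + add_time + 7))%N.

Lemma wp_distances ord par l T Q : topo ord par -> (l + dist_size n k <= P)%N ->
  (forall (p : {ffun 'I_n -> monomial R k}) T', (forall v, p v = pd G t par v) ->
    (T' <= T + distances_time)%N ->
    Q p (l + dist_size n k)%N T') ->
  wp P (distances G t ord par) l T Q.
Proof.
move=> tp; have rp := topo_rooted tp; have sn := size_topo tp; have [_ ao pt _] := tp.
rewrite /dist_size => lP HQ; rewrite /distances; apply: wp_alloc_bind; first by lia.
apply: (wp_for (c := (k.+1 + add_time + 7)%N)
  (Inv := fun s1 (p : {ffun 'I_n -> monomial R k}) l' =>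
   [/\ l' = (l + n + size s1 * k.+1)%N, (size s1 <= n)%N
     & forall v, v \in s1 -> p v = pd G t par v])).
- by split=> //; rewrite addn0.
- by move=> s1 ? ? [-> h _]; have := leq_mul h (leqnn k.+1); lia.
- move=> s1 u s2 p _ T' oE [-> _ hp].
  have s1n : (size s1 < n)%N.
    by move: sn; rewrite oE size_cat /=; lia.
  have := leq_mul s1n (leqnn k.+1); rewrite mulSn => sk.
  have upd_ok y : y = pd G t par u -> forall v, v \in rcons s1 u -> upd p u y v = pd G t par v.
    by move=> yE v; rewrite mem_rcons inE ffunE; case: eqP => [->|_ /hp].
  wp_step; case: ifPn => ut.
    apply: wp_alloc_bind; first by lia.
    apply: wp_op; first by lia.
    split; last by lia.
    split; rewrite ?size_rcons //; first by rewrite mulSn; lia.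
    by apply: upd_ok; rewrite (eqP ut) pd_root.
  do 3 wp_step; apply: wp_bind; apply: wp_add_weight; first by lia.
  move=> T2 hT2; apply: wp_op; first by lia.
  split; last by lia.
  split; rewrite ?size_rcons //; first by rewrite mulSn; lia.
  by apply: upd_ok; rewrite hp ?(topo_split tp oE) // -pd_step.
move=> p _ T' [-> _ hp]; rewrite sn => hT.
rewrite -addnA; apply: HQ; last by rewrite /distances_time; lia.
by move=> v; exact/hp/ao.
Qed.

Definition is_shortest_time m : nat := (m * (add_time + compare_time * 2 + 12))%N.

Lemma wp_is_shortest (al : seq ('I_n * 'I_n)) (par : {ffun 'I_n -> 'I_n})
    (p : {ffun 'I_n -> monomial R k}) l T (Q : bool -> nat -> nat -> Prop) :
  separated_variables G ->
  (forall v, p v = pd G t par v) -> (l + k.+1 <= P)%N ->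
  (forall (b : bool) T',
    (b <-> forall v w, (v, w) \in al ->
      ~ mlt G (wmono (D G v w) + pd G t par w) (pd G t par v)) ->
    (T' <= T + is_shortest_time (size al))%N -> Q b l T') ->
  wp P (is_shortest G al p) l T Q.
Proof.
move=> sep hp lP HQ; rewrite /is_shortest.
apply: (wp_for (c := (add_time + compare_time * 2 + 12)%N)
  (Inv := fun s1 (b : bool) l' => l' = l /\ (b <-> forall v w, (v, w) \in s1 ->
      ~ mlt G (wmono (D G v w) + pd G t par w) (pd G t par v)))).
- by [].
- by move=> ? ? ? [-> _]; lia.
- move=> s1 [v w] s2 ok _ T' _ [-> hok]; do 5 wp_step.
  apply: wp_bind; apply: wp_add_weight => //= T1 hT1.
  apply: wp_bind; apply: wp_compare => // fr T2 hfr hT2.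
  apply: wp_bind; apply: wp_compare => // rf T3 hrf hT3.
  apply: wp_free_bind; first by lia.
  rewrite addnK; wp_step; apply: wp_op; first by lia.
  split; last by lia.
  rewrite !hp in hfr hrf; split=> //.
  split=> [/andP[/hok h b] v' w'|h].
    rewrite mem_rcons inE => /orP[/eqP [-> ->]|]; last exact: h.
    by move=> [/hfr fr1 nrf]; apply: nrf; apply/hrf; rewrite fr1 in b.
  apply/andP; split.
    by apply/hok => v' w' s; apply: h; rewrite mem_rcons inE s orbT.
  apply/implyP => /hfr h1; apply: contrapT => h2.
  have vw : (v, w) \in rcons s1 (v, w) by rewrite mem_rcons inE eqxx.
  by apply: (h v w vw); split=> // /hrf.
move=> ok _ T' [-> hok] hT; exact: HQ.
Qed.

Definition arc_list_time : nat := (n * (1 + n * 6))%N.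

Lemma wp_arc_list l T Q : (l + 2 * #|arcs G| <= P)%N ->
  (forall al T', (forall v w, ((v, w) \in al) = is_arc G v w) -> size al = #|arcs G| ->
    (T' <= T + arc_list_time)%N -> Q al (l + 2 * #|arcs G|)%N T') ->
  wp P (arc_list G) l T Q.
Proof.
move=> lP HQ; rewrite /arc_list.
have szle (s : seq ('I_n * 'I_n)) : uniq s -> (forall a, a \in s -> is_arc G a.1 a.2) ->
    (size s <= #|arcs G|)%N.
  move=> us h; rewrite -(card_uniqP us); apply: subset_leq_card.
  by apply/fintype.subsetP => a /h; rewrite inE.
(* The tails begun are s1 and the heads scanned for v are [s2 v]; letting the heads depend on the
   tail makes one predicate serve both loops. *)
pose ok (s1 : seq 'I_n) (s2 : 'I_n -> seq 'I_n) (s : seq ('I_n * 'I_n)) l' :=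
  [/\ uniq s, forall v w, ((v, w) \in s) = (v \in s1) && (w \in s2 v) && is_arc G v w
    & l' = (l + 2 * size s)%N].
have okP s1 s2 s l' : ok s1 s2 s l' -> (l' <= P)%N.
  move=> [us hs ->]; apply: leq_trans lP; rewrite leq_add2l leq_mul2l szle //.
  by move=> [v w]; rewrite hs => /andP[].
apply: (wp_for (c := (1 + n * 6)%N) (Inv := fun s1 s l' => ok s1 (fun=> enum 'I_n) s l')).
- by split=> //; rewrite addn0.
- by move=> ? ? ?; exact: okP.
- move=> s1 v s2 s l1 T1 sE h1.
  have vs1 : v \notin s1.
    have := enum_uniq 'I_n; rewrite sE cat_uniq => /and3P[_ + _] /=.
    by rewrite negb_or => /andP[].
  apply: (wp_for (c := 6)
    (Inv := fun s1' s l' => ok (rcons s1 v) (fun u => if u == v then s1' else enum 'I_n) s l')).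
  + have [us hs ->] := h1; split=> // u w; rewrite hs mem_rcons inE.
    by case: (eqVneq u v) => [->|//]; rewrite (negPf vs1).
  + by move=> ? ? ?; exact: okP.
  + move=> s1' w s2' s' l2 T2 sE' h2; have l2P := okP _ _ _ _ h2.
    have ws1 : w \notin s1'.
      have := enum_uniq 'I_n; rewrite sE' cat_uniq => /and3P[_ + _] /=.
      by rewrite negb_or => /andP[].
    have [us hs l2E] := h2.
    have skip : ~~ is_arc G v w ->
        ok (rcons s1 v) (fun u => if u == v then rcons s1' w else enum 'I_n) s' l2.
      move=> nvw; split=> // u x; rewrite hs; have [->|//] := eqVneq u v.
      rewrite [x \in rcons _ _]mem_rcons inE; have [->|//] := eqVneq x w.
      by rewrite (negPf nvw) !andbF.
    have push : is_arc G v w -> wp P (do* alloc 2 in op (rcons s' (v, w))) l2 T2.+1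
        (fun st' l' T' => ok (rcons s1 v)
          (fun u => if u == v then rcons s1' w else enum 'I_n) st' l' /\ (T' < T2 + 6)%N).
      move=> vw; have h3 : ok (rcons s1 v)
          (fun u => if u == v then rcons s1' w else enum 'I_n) (rcons s' (v, w)) (l2 + 2)%N.
        split; last by rewrite size_rcons l2E; lia.
          by rewrite rcons_uniq us hs eqxx (negPf ws1) andbF.
        move=> u x; rewrite mem_rcons inE hs xpair_eqE.
        have [->|//] := eqVneq u v; rewrite !mem_rcons !inE eqxx.
        by have [->|//] := eqVneq x w; rewrite vw.
      have l3P := okP _ _ _ _ h3.
      by apply: wp_alloc_bind => //; apply: wp_op => //; split=> //; lia.
    wp_step; move: skip push; rewrite /is_arc; case: (D G v w) => [|c|i] skip push.
    * by apply: wp_ret => //; split; [exact: skip | lia].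
    * exact: push.
    * exact: push.
  move=> s' l2 T2 [us hs ->]; rewrite size_enum_ord => hT; split; last by lia.
  by split=> // u w; rewrite hs; case: ifP.
move=> al l1 T1 [us hs ->]; rewrite size_enum_ord => hT.
have hal v w : ((v, w) \in al) = is_arc G v w by rewrite hs !mem_enum.
have szE : size al = #|arcs G|.
  by rewrite -(card_uniqP us); apply: eq_card => -[v w]; rewrite hal inE.
by rewrite szE; apply: HQ.
Qed.

End Subroutines.

(** * Replacing one arc of a stored tree *)

Section PivotProgram.
Variables (n : nat) (t : 'I_n) (P : nat).

Definition pivot_time : nat := (n * 20 + 3)%N.

Lemma fconnect_root (f : {ffun 'I_n -> 'I_n}) v : f t = t -> v != t ->
  fconnect f t v = false.
Proof.
move=> ft vt; apply/negP => /iter_findex; rewrite ffun_iter_fix // => e.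
by rewrite e eqxx in vt.
Qed.

(** Both groups keep their inner order, and a node other than v lies in the same group as its
    parent. The new parent w of v belongs to the first group, which precedes v. *)
Lemma topo_pivot ord (par : {ffun 'I_n -> 'I_n}) v w : topo t ord par -> v != t ->
  ~~ fconnect par w v ->
  topo t ([seq u <- ord | ~~ fconnect par u v] ++ [seq u <- ord | fconnect par u v])
    (upd par v w).
Proof.
move=> tp vt wv; have [uo ao pt h] := tp; split.
- rewrite cat_uniq !filter_uniq // andbT /= -all_predC; apply/allP => u.
  by rewrite /= !mem_filter => /andP[uv _]; rewrite uv.
- by move=> u; rewrite mem_cat !mem_filter ao !andbT orNb.
- by rewrite ffunE eq_sym (negPf vt).
move=> u ut; rewrite ffunE; have [->|uv] := eqVneq u v.
  rewrite -cat1s; apply: cat_subseq; rewrite sub1seq mem_filter ao ?wv //.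
  by rewrite connect0.
have uE : fconnect par u v = fconnect par (par u) v by rewrite fconnect_eqVf (negPf uv).
have [cu|cu] := boolP (fconnect par u v).
  apply: subseq_trans (suffix_subseq _ _); rewrite subseq_filter h // andbT /=.
  by rewrite -uE cu.
apply: subseq_trans (prefix_subseq _ _); rewrite subseq_filter h // andbT /=.
by rewrite -uE cu.
Qed.

Lemma wp_pivot ord (par : {ffun 'I_n -> 'I_n}) v w l T Q :
  topo t ord par -> v != t -> (l + 3 * n <= P)%N ->
  (forall T', (T' <= T + pivot_time)%N ->
    Q ([seq u <- ord | ~~ fconnect par u v] ++ [seq u <- ord | fconnect par u v],
       upd par v w) (l + 2 * n)%N T') ->
  wp P (pivot t ord par v w) l T Q.
Proof.
move=> tp vt lP HQ; have [uo ao pt h] := tp; have sn := size_topo tp.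
rewrite /pivot; apply: wp_alloc_bind; first by lia.
apply: wp_bind; apply: (wp_for (c := 5) (Inv := fun s1 (mk : {ffun 'I_n -> bool}) l' =>
  l' = (l + n)%N /\ forall u, mk u = (u \in s1) && fconnect par u v)).
- by split=> // u; rewrite ffunE.
- by move=> ? ? ? [-> _]; lia.
- move=> s1 u s2 mk _ T1 oE [-> hm]; wp_step.
  have us1 : u \notin s1.
    by move: uo; rewrite oE cat_uniq /= negb_or => /and3P[_ /andP[]].
  case: ifPn => uv.
    apply: wp_op; first by lia.
    split; last by lia.
    split=> // x; rewrite ffunE mem_rcons inE hm.
    by have [->|] := eqVneq x u; rewrite // (eqP uv) connect0.
  do 2 wp_step; apply: wp_op; first by lia.
  split; last by lia.
  split=> // x; rewrite ffunE mem_rcons inE !hm.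
  have [->|//] := eqVneq x u; rewrite /= [RHS]fconnect_eqVf (negPf uv) /=.
  have [ut|ut] := eqVneq u t; last by rewrite (topo_split tp oE ut).
  (* The root is its own parent and reads its own mark, still [false]; this is right, as t is not
     below v. *)
  rewrite ut pt -ut (negPf us1) /=.
  by rewrite ut fconnect_root.
move=> mk _ T1 [-> hm]; rewrite sn => hT1.
have {}hm u : mk u = fconnect par u v by rewrite hm ao.
apply: wp_alloc_bind; first by lia.
apply: wp_bind; apply: (wp_for (c := 3) (Inv := fun s1 (f : {ffun 'I_n -> 'I_n}) l' =>
  l' = (l + n + n)%N /\ forall u, u \in s1 -> f u = par u)).
- by [].
- by move=> ? ? ? [-> _]; lia.
- move=> s1 u s2 f _ T2 _ [-> hf]; wp_step; apply: wp_op; first by lia.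
  split; last by lia.
  split=> // x; rewrite ffunE mem_rcons inE.
  by have [->//|_] := eqVneq x u; exact: hf.
move=> f _ T2 [-> hf]; rewrite size_enum_ord => hT2.
have {hf} -> : f = par by apply/ffunP => u; rewrite hf // mem_enum.
wp_step; apply: wp_alloc_bind; first by lia.
apply: wp_bind; apply: (wp_for (c := 4) (Inv := fun s1 o l' =>
  l' = (l + n + n + n)%N /\ o = [seq u <- s1 | ~~ fconnect par u v])).
- by [].
- by move=> ? ? ? [-> _]; lia.
- move=> s1 u s2 o _ T3 _ [-> ->]; wp_step; rewrite hm filter_rcons; case: ifPn => uv /=.
    by apply: wp_ret; [lia | split=> //; lia].
  by apply: wp_op; [lia | split=> //; lia].
move=> o _ T3 [-> ->]; rewrite sn => hT3.
apply: wp_bind; apply: (wp_for (c := 4) (Inv := fun s1 o l' =>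
  l' = (l + n + n + n)%N /\
  o = [seq u <- ord | ~~ fconnect par u v] ++ [seq u <- s1 | fconnect par u v])).
- by rewrite cats0.
- by move=> ? ? ? [-> _]; lia.
- move=> s1 u s2 o' _ T4 _ [-> ->]; wp_step; rewrite hm filter_rcons; case: ifPn => uv /=.
    by apply: wp_op; [lia | split; [rewrite rcons_cat | lia]].
  by apply: wp_ret; [lia | split=> //; lia].
move=> o' _ T4 [-> ->]; rewrite sn => hT4.
apply: wp_free_bind; first by lia.
apply: wp_ret; first by lia.
have -> : (l + n + n + n - n = l + 2 * n)%N by lia.
by apply: HQ; rewrite /pivot_time; lia.
Qed.

End PivotProgram.

(** * The store of trees already considered *)

Section Tries.
Variables (n P : nat).
(* [ok u a]: the letter a may occur at the position of the node u.  Siblings in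
   the trie are distinct, so that a lookup costs at most the number of such pairs
   and not n per level. *)
Variable ok : 'I_n -> 'I_n -> bool.
Implicit Types (T : trie n) (us ws : seq 'I_n) (par : {ffun 'I_n -> 'I_n}).

Fixpoint tmem T ws : bool := match T, ws with
  | Branch a T1 T2, x :: ws' =>
      if a == x then (if ws' is [::] then true else tmem T1 ws') else tmem T2 ws
  | _, _ => false
  end.

Fixpoint labels T : seq 'I_n := if T is Branch a _ T2 then a :: labels T2 else [::].

Fixpoint twf T us : bool := match T, us with
  | Nil, _ => true
  | Branch a T1 T2, u :: us' => [&& ok u a, a \notin labels T2, twf T1 us' & twf T2 us]
  | _, _ => false
  end.

Definition outdeg u : nat := #|[pred a | ok u a]|.

Definition word_cost us : nat := \sum_(u <- us) outdeg u.

Lemma size_labels T u us : twf T (u :: us) -> (size (labels T) <= outdeg u)%N.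
Proof.
move=> wT; suff [ul sl] : uniq (labels T) /\ {subset labels T <= [pred a | ok u a]}.
  by rewrite -(card_uniqP ul); apply: subset_leq_card; apply/fintype.subsetP.
elim: T wT => //= a T1 _ T2 IH /and4P[ua -> _ /IH [-> sl]]; split=> // b.
by rewrite inE => /orP[/eqP ->|/sl].
Qed.

Lemma labels_word_cost T us : twf T us ->
  (size (labels T) + word_cost (behead us) <= word_cost us)%N.
Proof.
case: us => [|u us] wT; first by case: T wT.
by rewrite /word_cost big_cons leq_add2r; exact: size_labels wT.
Qed.

(** The current level costs the siblings still ahead, the deeper levels the full word cost; this
    form survives both recursive calls. *)
Lemma wp_lookup par T us l τ (Q : bool -> nat -> nat -> Prop) : (l <= P)%N -> twf T us ->
  (forall τ', (τ' <= τ + 2 * size (labels T) + 2 * word_cost (behead us) + 1)%N ->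
    Q (tmem T (map par us)) l τ') ->
  wp P (lookup par T us) l τ Q.
Proof.
move=> lP; elim: T us τ Q => [|a T1 IH1 T2 IH2] [|u us] τ Q wT HQ;
  try by apply: wp_op => //; apply: HQ; lia.
have /and4P[_ _ w1 w2] := wT; rewrite [lookup _ _ _]/=; do 2 wp_step.
rewrite [tmem _ _]/= [labels _]/= [behead _]/= [size _]/= in HQ; case: ifPn HQ => ax HQ.
  case: us w1 {w2 wT} HQ => [|u' us] w1 HQ; first by apply: wp_ret => //; apply: HQ; lia.
  by apply: IH1 => // τ' hτ; apply: HQ; have := labels_word_cost w1; move: hτ; lia.
by apply: IH2 => // τ' hτ; apply: HQ; move: hτ => /=; lia.
Qed.

(** The clause on membership excludes the empty word, which [Nil] does not store. *)
Lemma wp_chain par us l τ Q : (l + 3 * size us <= P)%N ->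
  (forall T' τ', twf T' us ->
    (forall a, a \in labels T' -> a = par (head a us)) ->
    (us != [::] -> forall ws, size ws = size us -> tmem T' ws = (ws == map par us)) ->
    (τ' <= τ + 5 * size us + 1)%N -> Q T' (l + 3 * size us)%N τ') ->
  (forall u, u \in us -> ok u (par u)) ->
  wp P (chain par us) l τ Q.
Proof.
elim: us l τ Q => [|u us IH] l τ Q lP HQ hok.
  by rewrite /= muln0 addn0 in lP HQ; apply: wp_op => //; apply: HQ => //; lia.
have hok' u' : u' \in us -> ok u' (par u') by move=> h; apply: hok; rewrite inE h orbT.
rewrite /= in lP HQ; apply: wp_alloc_bind; first by lia.
wp_step; apply: wp_bind; apply: IH => //; first by lia.
move=> T' τ' wT _ mT hτ; apply: wp_op; first by lia.
have -> : (l + 3 + 3 * size us = l + 3 * (size us).+1)%N by lia.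
apply: HQ => //; last by lia.
- by apply/and4P; split=> //; apply: hok; rewrite inE eqxx.
- by move=> a; rewrite inE => /eqP.
- move=> _ [|x ws] //= [sw]; rewrite eqseq_cons [x == _]eq_sym.
  case: ifP => //= _; case: ws sw => [|y ws] sw; first by rewrite (size0nil (esym sw)).
  have us0 : us != [::] by apply/eqP => us0; rewrite us0 in sw.
  by rewrite mT.
Qed.

(** The clause on labels keeps siblings distinct: the top level can only gain the first letter of
    the word, and this happens after it was compared with all the siblings. *)
Lemma wp_insert par T us l τ Q : (l + 3 * size us <= P)%N -> twf T us ->
  (forall u, u \in us -> ok u (par u)) ->
  (forall T' l' τ', twf T' us ->
    (forall a, a \in labels T' -> a \in labels T \/ a = par (head a us)) ->
    (us != [::] -> forall ws, size ws = size us ->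
      tmem T' ws = (ws == map par us) || tmem T ws) ->
    (l' <= l + 3 * size us)%N ->
    (τ' <= τ + 3 * size (labels T) + 3 * word_cost (behead us) + 5 * size us + 1)%N ->
    Q T' l' τ') ->
  wp P (insert par T us) l τ Q.
Proof.
move=> lP wT hok; elim: T us τ Q lP wT hok => [|a T1 IH1 T2 IH2] us τ Q lP wT hok HQ.
  apply: wp_chain => // T' τ' wT' lT' mT' hτ; apply: HQ => //; last by lia.
    by move=> b /lT'; right.
  by move=> us0 ws sw; rewrite mT' // orbF.
case: us wT lP hok HQ => [//|u us] wT lP hok HQ; have /and4P[ua al w1 w2] := wT.
have hok' u' : u' \in us -> ok u' (par u') by move=> h; apply: hok; rewrite inE h orbT.
rewrite [insert _ _ _]/=; do 2 wp_step; rewrite /= in lP HQ; case: ifPn => ax.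
  apply: wp_bind; apply: IH1 => //; first by lia.
  move=> T' l' τ' wT' lT' mT' hl hτ; apply: wp_op; first by lia.
  apply: HQ => //=.
  - by apply/and4P; split.
  - by move=> b ->; left.
  - move=> _ [|x ws] //= [sw]; rewrite eqseq_cons [x == _]eq_sym (eqP ax).
    case: ifP => //= _; case: ws sw => [|y ws] sw; first by rewrite orbT.
    have us0 : us != [::] by apply/eqP => us0; rewrite us0 in sw.
    by rewrite mT'.
  - by lia.
  have := labels_word_cost w1.
  by lia.
apply: wp_bind; apply: IH2 => // T' l' τ' wT' lT' mT' hl hτ; apply: wp_op.
  by move: hl => /=; lia.
apply: HQ => //=.
- apply/and4P; split=> //; apply/negP => /lT' /= [h|ae]; first by rewrite h in al.
  by rewrite ae eqxx in ax.
- move=> b; rewrite inE => /orP[/eqP ->|/lT' [h|->]]; last by right.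
    by left; rewrite inE eqxx.
  by left; rewrite inE h orbT.
- move=> _ [|x ws] sw; rewrite ?[_ == _]/= //=; case: ifP => [/eqP <-|_].
    by rewrite eqseq_cons (negPf ax).
  by rewrite mT'.
by move: hτ => /=; lia.
Qed.

End Tries.

(** * Memory and time budgets *)

Definition item_words n k : nat := (5 * n + dist_size n k + 3)%N.

(** For each arc, a monomial of k + 1 words and a pair of pointers. In [item_words], 5n is 2n for
    the order and the parents and 3n for a new branch of the trie; the 3 is the queue entry. *)
Definition system_words m k : nat := (m * (k + 3))%N.

(** A candidate under construction, the n marks used by [pivot], and one monomial under
    comparison. *)
Definition scratch_words n k : nat := (item_words n k + n + k + 1)%N.

(** Without variables no two lengths are incomparable and no pivot is charged; otherwise the case k
    = 0 would exceed the n^2 that the final bound leaves for it. *)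
Definition arc_time n k m : nat := (add_time k + 2 * compare_time k + 10 +
  if k == 0 then 0 else pivot_time n + distances_time n k + is_shortest_time k m +
    5 * m + 5 * n + 30)%N.

Definition tree_time n k m : nat := (m * arc_time n k m + 3)%N.

Lemma room_bound (N S iw B x y z sc l P : nat) : (N <= S)%N ->
  (B + S * iw + z + sc <= P)%N -> (l <= B + N * iw + x)%N -> (x + y)%N = z ->
  (l + y + sc <= P)%N.
Proof. by move=> NS; have := leq_mul NS (leqnn iw); lia. Qed.

Lemma new_item_bound n k (B N x li l : nat) :
  (li <= B + N * item_words n k + x * (k + 3))%N ->
  (l <= li + k.+1 + 2 + 2 * n + dist_size n k + 3 * n)%N ->
  (l + 3 <= B + N.+1 * item_words n k + x.+1 * (k + 3))%N.
Proof.
by rewrite !mulSn; move: (N * _)%N (x * _)%N => y z; rewrite /item_words; lia.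
Qed.

(** S bounds the number of trees, N of them queued and [out] of them output. Queued trees occupy iw
    words, output trees iw + sw, and the latter is reserved for all S. *)
Lemma main_room (S iw sw B N out sc l P : nat) : (out + N <= S)%N ->
  (B + S * (iw + sw) + sc <= P)%N -> (l <= B + (out + N) * iw + out * sw)%N -> (l <= P)%N.
Proof.
move=> h; have := leq_mul h (leqnn iw).
have := leq_mul (leq_trans (leq_addr _ _) h) (leqnn sw).
by rewrite mulnDr; move: (S * iw)%N (S * sw)%N (out * sw)%N (_ * iw)%N; lia.
Qed.

Lemma process_room (S iw sw B N out sc P : nat) : (out + N.+1 <= S)%N ->
  (B + S * (iw + sw) + sc <= P)%N -> (B + out * sw + S * iw + sw + sc <= P)%N.
Proof.
rewrite addnS => h; have := leq_mul (leq_ltn_trans (leq_addr _ _) h) (leqnn sw).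
by rewrite mulnDr mulSn; move: (S * iw)%N (S * sw)%N (out * sw)%N; lia.
Qed.

Lemma tree_time_bound (x out out' T T1 T2 : nat) : (out < out')%N ->
  (T1 <= T.+1 + x)%N -> (T2 <= T1.+2 + (out' - out.+1) * (x + 3) + 1)%N ->
  (T2 <= T + (out' - out) * (x + 3) + 1)%N.
Proof.
move=> h; have -> : (out' - out = (out' - out.+1).+1)%N by lia.
by rewrite mulSn; move: (_ * _)%N; lia.
Qed.

Section ArcTime.
Variables (n k m T T1 T2 T3 T4 T5 T6 T7 : nat).
Hypotheses (k0 : k != 0%N) (h1 : (T1 <= T.+1.+4 + add_time k)%N)
  (h2 : (T2 <= T1 + compare_time k)%N) (h3 : (T3 <= T2 + compare_time k)%N)
  (h4 : (T4 <= (T3.+1 + 2).+1 + pivot_time n)%N) (h5 : (T5 <= T4 + distances_time n k)%N)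
  (h6 : (T6 <= T5 + is_shortest_time k m)%N) (h7 : (T7 <= T6 + 2 * m + 3)%N).

Lemma reject_time : (T7.+1 < T + arc_time n k m)%N.
Proof. by rewrite /arc_time (negPf k0); lia. Qed.

Lemma accept_time T8 L c c' : (L + c' <= c)%N -> (c <= m.+1)%N ->
  (T8 <= T7 + 3 * L + 3 * c' + 5 * n + 1)%N -> ((T8 + 3).+1 < T + arc_time n k m)%N.
Proof. by rewrite /arc_time (negPf k0); lia. Qed.

End ArcTime.

Ltac room h := move: h; clear; lia.

(** * One round of the traversal, and the loop *)

Section MainLoop.
Variables (R : realType) (n k : nat) (G : network R n k) (t : 'I_n) (P : nat).
Implicit Types (f g : {ffun 'I_n -> 'I_n}) (u v w : 'I_n) (sl : seq {ffun 'I_n -> 'I_n}).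
Hypotheses (sep : separated_variables G) (gen : generic G).

Local Notation m := #|arcs G|.
Local Notation sigma := #|spts G t|.
Local Notation word f := [seq f i | i <- enum 'I_n].

Definition parent_ok u a : bool := is_arc G u a || (u == t) && (a == t).

(** Each arc is counted once, at its tail; the extra 1 is the pair (t, t), which occurs in the
    stored words because the root is its own parent. *)
Lemma word_cost_arcs : (word_cost parent_ok (enum 'I_n) <= m.+1)%N.
Proof.
rewrite /word_cost big_enum /=.
apply: leq_trans (_ : _ <= \sum_(u < n) (#|[pred a | is_arc G u a]| + (u == t)))%N _.
  apply: leq_sum => u _; have [->|ut] := eqVneq u t; last first.
    rewrite addn0; apply: subset_leq_card; apply/fintype.subsetP => a.
    by rewrite !inE /parent_ok (negPf ut) orbF.
  rewrite addn1 /outdeg; apply: leq_trans (_ : _ <=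
    #|[predU [pred a | is_arc G t a] & pred1 t]|)%N _.
    by apply: subset_leq_card; apply/fintype.subsetP => a; rewrite !inE /parent_ok eqxx.
  have := cardUI [pred a | is_arc G t a] (pred1 t); rewrite card1 addn1 => <-.
  exact: leq_addr.
rewrite big_split /= -addn1; apply: leq_add.
  under eq_bigr do rewrite -sum1_card.
  rewrite pair_big_dep /= sum1dep_card; apply: subset_leq_card.
  by apply/fintype.subsetP => -[u a]; rewrite !inE.
by rewrite (bigD1 t) //= eqxx big1 // => u /negPf ->.
Qed.

Lemma intree_parent_ok f u : intree G t f -> parent_ok u (f u).
Proof.
move=> [[ft _] af]; rewrite /parent_ok; have [->|ut] := eqVneq u t.
  by rewrite ft eqxx orbT.
by rewrite af.
Qed.

Definition seen_ok (T : trie n) sl : Prop :=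
  twf parent_ok T (enum 'I_n) /\ forall f, tmem T (word f) = (f \in sl).

Lemma word_inj f g : word f = word g -> f = g.
Proof. by move=> /eq_in_map h; apply/ffunP => v; apply: h; rewrite mem_enum. Qed.

Definition good_item (x : item R n k) : Prop :=
  [/\ topo t x.1.1 x.1.2, spt G t x.1.2 & forall v, x.2 v = pd G t x.1.2 v].

(** [swap_closed] for the single tree f, with sl the trees output or queued; it persists as sl
    grows. *)
Definition swapped f sl := forall v w, is_arc G v w -> incomparable G t f v w ->
  spt G t (upd f v w) -> upd f v w \in sl.

Lemma incomparable_dim f v w : incomparable G t f v w -> k != 0%N.
Proof.
move=> [h1 h2]; apply/eqP => k0.
have E (h : monomial R k) z : meval h z = h.1.
  rewrite /meval big1 ?addr0 // => i; by have := ltn_ord i; lia.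
have [le|lt] := leP (pd G t f v).1 (wmono (D G v w) + pd G t f w).1.
  by apply: h1 => z _; rewrite !E.
by apply: h2 => z _; rewrite !E ltW.
Qed.

Lemma spts_size sl : uniq sl -> (forall f, f \in sl -> spt G t f) -> (size sl <= sigma)%N.
Proof.
move=> us h; rewrite -(card_uniqP us); apply: subset_leq_card.
by apply/fintype.subsetP => f /h /sptsP.
Qed.

(** [new] holds the items appended in this round, and B counts the words outside the items of known
    trees. Room for a whole system is reserved beforehand, k + 3 words per arc. *)
Lemma wp_process al ord par p (Q0 : seq (item R n k)) seen sl l T B Q :
  (forall v w, ((v, w) \in al) = is_arc G v w) -> size al = m ->
  good_item (ord, par, p) -> seen_ok seen sl -> uniq sl ->
  (forall f, f \in sl -> spt G t f) ->
  (l <= B + size sl * item_words n k)%N ->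
  (B + sigma * item_words n k + system_words m k + scratch_words n k <= P)%N ->
  (forall new seen' sys l' T', let sl' := sl ++ [seq x.1.2 | x <- new] in
    (forall x, x \in new -> good_item x) -> seen_ok seen' sl' -> uniq sl' ->
    (forall f, f \in sl' -> spt G t f) -> swapped par sl' ->
    (forall z, feasible G z ->
      (forall fg, fg \in sys -> meval fg.1 z <= meval fg.2 z) <-> tight G t par z) ->
    (l' <= B + size sl' * item_words n k + system_words m k)%N ->
    (T' <= T + m * arc_time n k m)%N -> Q (Q0 ++ new, seen', sys) l' T') ->
  wp P (process G t al (ord, par, p) Q0 seen) l T Q.
Proof.
move=> hal sal [/= tp sp hp] so0 us0 ss0 lB BP HQ; have [itp nlt] := sp.
pose Inv (s1 : seq ('I_n * 'I_n))
    (st : seq (item R n k) * trie n * seq (monomial R k * monomial R k)) l' :=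
  exists new, let sl' := sl ++ [seq x.1.2 | x <- new] in
  [/\ st.1.1 = Q0 ++ new, (forall x, x \in new -> good_item x), seen_ok st.1.2 sl',
    uniq sl' &
  [/\ (forall f, f \in sl' -> spt G t f),
    (forall v w, (v, w) \in s1 -> incomparable G t par v w -> spt G t (upd par v w) ->
      upd par v w \in sl'),
    (forall z, feasible G z ->
      (forall fg, fg \in st.2 -> meval fg.1 z <= meval fg.2 z) <->
      forall v w, (v, w) \in s1 ->
        meval (pd G t par v) z <= meval (wmono (D G v w) + pd G t par w) z),
    (size s1 <= m)%N &
    (l' <= B + size sl' * item_words n k + size s1 * (k + 3))%N]].
(* The room reserved for the arcs still to come, hidden behind an equation so that linear arithmetic
   treats it as an atom. *)
have [rest restE] : exists rest : nat -> nat, forall x, rest x = ((m - x) * (k + 3))%N.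
  by eexists.
have InvP s1 st l' : Inv s1 st l' -> (l' + rest (size s1) + scratch_words n k <= P)%N.
  move=> [new [_ _ _ us [ss _ _ s1m hl]]]; have := spts_size us ss => h.
  have e : (size s1 * (k + 3) + rest (size s1) = system_words m k)%N.
    by rewrite restE -mulnDl subnKC.
  exact: room_bound h BP hl e.
have InvPl s1 st l' : Inv s1 st l' -> (l' <= P)%N by move=> /InvP; lia.
rewrite /process; apply: (wp_for (c := arc_time n k m) (Inv := Inv)).
- exists [::]; rewrite /= !cats0; split=> //; split=> //; by rewrite mul0n addn0.
- exact: InvPl.
- move=> s1 [v w] s2 [[Qi seeni] sysi] li Ti alE Ii.
  have vw : is_arc G v w by rewrite -hal alE mem_cat inE eqxx orbT.
  have s1m : (size s1 < m)%N by rewrite -sal alE size_cat /=; lia.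
  have liP := InvP _ _ _ Ii.
  have slotE : rest (size s1) = (k + 3 + rest (size s1).+1)%N.
    by rewrite !restE -subSS subSn // mulSn.
  rewrite slotE /scratch_words /item_words in liP.
  have [new [/= QE gnew so us [ss sw hsys _ hl]]] := Ii.
  do 5 (apply: wp_op_bind; [by room liP | cbv beta]).
  apply: wp_bind; apply: wp_add_weight => //=; first by room liP.
  move=> T1 hT1; apply: wp_bind; apply: wp_compare => //; first by room liP.
  move=> rf T2 hrf hT2; apply: wp_bind; apply: wp_compare => //; first by room liP.
  move=> fr T3 hfr hT3; rewrite !hp in hrf hfr *; apply: wp_op_bind; [by room liP | cbv beta].
  have sysE z : feasible G z -> mle G (pd G t par v) (wmono (D G v w) + pd G t par w) ->
      (forall fg, fg \in sysi -> meval fg.1 z <= meval fg.2 z) <->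
      forall v' w', (v', w') \in rcons s1 (v, w) ->
        meval (pd G t par v') z <= meval (wmono (D G v' w') + pd G t par w') z.
    move=> fz le; rewrite hsys //; split=> h v' w'.
      by rewrite mem_rcons inE => /orP[/eqP [-> ->]|/h //]; exact: le.
    by move=> s; apply: h; rewrite mem_rcons inE s orbT.
  have bound1 : (B + size (sl ++ [seq x.1.2 | x <- new]) * item_words n k +
       size s1 * (k + 3) + (k + 3) =
     B + size (sl ++ [seq x.1.2 | x <- new]) * item_words n k +
       size (rcons s1 (v, w)) * (k + 3))%N.
    by rewrite size_rcons mulSn; clear; lia.
  case: ifPn => cmp.
    (* In a shortest-path tree comparable lengths can only mean that the tree path is nowhere
       longer, so leaving out this inequality does not change the system. *)
    have le : mle G (pd G t par v) (wmono (D G v w) + pd G t par w).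
      case/orP: cmp => [/hrf //|/hfr h]; apply: contrapT => nle.
      exact: (nlt v w vw).
    apply: wp_free_bind; first by room liP.
    rewrite addnK; apply: wp_ret; first by room liP.
    split; last by move: hT1 hT2 hT3; rewrite /arc_time; clear; lia.
    exists new; split=> //; split=> //; rewrite ?size_rcons //.
    + move=> v' w'; rewrite mem_rcons inE => /orP[/eqP [-> ->]|]; last exact: sw.
      by move=> [].
    + by move=> z fz; exact: sysE.
    + by move: bound1 hl; rewrite size_rcons; clear; lia.
  have inc : incomparable G t par v w.
    by move: cmp; rewrite negb_or => /andP[/negP h1 /negP h2]; split=> [/hrf|/hfr].
  have kn0 := incomparable_dim inc.
  have [vt wv itp'] := incomparable_pivot sep gen itp vw inc.
  have tp' := topo_pivot tp vt wv.
  have sysE2 z : feasible G z ->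
      (forall fg, fg \in rcons sysi (pd G t par v, wmono (D G v w) + pd G t par w) ->
         meval fg.1 z <= meval fg.2 z) <->
      forall v' w', (v', w') \in rcons s1 (v, w) ->
        meval (pd G t par v') z <= meval (wmono (D G v' w') + pd G t par w') z.
    move=> fz; have [hs1 hs2] := hsys z fz; split=> h.
      move=> v' w'; rewrite mem_rcons inE => /orP[/eqP [-> ->]|].
        by have := h (pd G t par v, wmono (D G v w) + pd G t par w);
          rewrite mem_rcons inE eqxx; apply.
      apply: hs1 => fg fgs; apply: h; by rewrite mem_rcons inE fgs orbT.
    move=> fg; rewrite mem_rcons inE => /orP[/eqP ->|].
      by apply: h; rewrite mem_rcons inE eqxx.
    by apply: hs2 => v' w' s; apply: h; rewrite mem_rcons inE s orbT.
  apply: wp_alloc_bind; first by room liP.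
  apply: wp_op_bind; [by room liP | cbv beta].
  apply: wp_bind; apply: wp_pivot => //; first by room liP.
  move=> T4 hT4; cbv beta iota; apply: wp_bind; apply: wp_distances => //; first by room liP.
  move=> p' T5 hp' hT5; apply: wp_bind; apply: (wp_is_shortest sep hp'); first by room liP.
  move=> okb T6 hok hT6; rewrite sal in hT6.
  have {}hok : okb <-> spt G t (upd par v w).
    rewrite hok; split=> [h|[_ h] v' w' s].
      by split=> // v' w' vw'; apply: h; rewrite hal.
    by apply: h; rewrite -hal.
  have word_le := word_cost_arcs.
  have [wso mso] := so; have lwc := labels_word_cost wso.
  apply: wp_bind; set c0 := (X in wp _ X); apply: (@wp_conseq _ _ c0 _ _ (fun old l' T' =>
    [/\ l' = (li + k.+1 + 2 + 2 * n + dist_size n k)%N, (T' <= T6 + 2 * m + 3)%N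
      & old = ~~ okb || (upd par v w \in sl ++ [seq x.1.2 | x <- new])])).
    rewrite /c0; case: ifP => okE; last first.
      by apply: wp_ret; [room liP | split=> //; clear; lia].
    apply: (wp_lookup (ok := parent_ok)) => //; first by room liP.
    by move=> T7 hT7; split=> //; move: hT7 lwc word_le; clear; lia.
  move=> {c0} old _ T7 [-> hT7 ->]; case: ifPn => [old1|].
    apply: wp_free_bind; first by room liP.
    apply: wp_ret; first by room liP.
    split; last exact: reject_time kn0 hT1 hT2 hT3 hT4 hT5 hT6 hT7.
    exists new; split=> //; split=> //; rewrite ?size_rcons //.
      move=> v' w'; rewrite mem_rcons inE => /orP[/eqP [-> ->]|]; last exact: sw.
      by move=> _ /hok okt; rewrite okt in old1.
    by move: bound1 hl; rewrite size_rcons; clear; lia.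
  rewrite negb_or negbK => /andP[/hok spt' nold].
  apply: wp_bind; apply: (wp_insert (ok := parent_ok)) => //.
  + by rewrite size_enum_ord; room liP.
  + by move=> u _; exact: intree_parent_ok.
  move=> seen' l8 T8 wT' _ mT' hl8 hT8; rewrite size_enum_ord in hl8 hT8.
  have l8P : (l8 + 3 <= P)%N by move: liP hl8; clear; lia.
  apply: wp_alloc_bind; first by room l8P.
  apply: wp_op_bind; [by room l8P | cbv beta]; apply: wp_ret; first by room l8P.
  have acc := accept_time kn0 hT1 hT2 hT3 hT4 hT5 hT6 hT7.
  split; last exact: acc _ _ _ _ lwc word_le hT8.
  have cE2 : sl ++ [seq x.1.2 | x <- rcons new
      ([seq u <- ord | ~~ fconnect par u v] ++ [seq u <- ord | fconnect par u v],
        upd par v w, p')] = rcons (sl ++ [seq x.1.2 | x <- new]) (upd par v w).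
    by rewrite map_rcons rcons_cat.
  exists (rcons new ([seq u <- ord | ~~ fconnect par u v] ++ [seq u <- ord | fconnect par u v],
        upd par v w, p')); rewrite cE2; split=> //=.
  + by rewrite QE rcons_cat.
  + by move=> x; rewrite mem_rcons inE => /orP[/eqP ->|/gnew //]; split.
  + split=> // f; rewrite mem_rcons inE -mso mT' ?size_map //.
      by congr (_ || _); apply/eqP/eqP => [/word_inj|->].
    by rewrite -size_eq0 size_enum_ord -lt0n (leq_ltn_trans _ (ltn_ord t)).
  + by rewrite rcons_uniq us nold.
  split=> //; rewrite ?size_rcons //.
    by move=> f; rewrite mem_rcons inE => /orP[/eqP ->|/ss].
    move=> v' w'; rewrite !mem_rcons !inE => /orP[/eqP [-> ->]|s i1 i2].
      by rewrite eqxx.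
    by rewrite sw // orbT.
  exact: new_item_bound hl hl8.
- move=> [[Qe seene] syse] le Te [new [/= -> gnew so us [ss sw hsys _ hl]]] hT.
  rewrite sal in hl hT; apply: HQ => //.
  + by move=> v w vw; apply: sw; rewrite hal.
  + move=> z fz; rewrite hsys //; split=> h v w vw.
      by rewrite -mevalD; apply: h; rewrite hal.
    by rewrite mevalD; apply: h; rewrite -hal.
Qed.

Definition good_result (r : result R n k) : Prop :=
  (forall v, r.1.2 v = pd G t r.1.1 v) /\
  forall z, feasible G z ->
    (forall fg, fg \in r.2 -> meval fg.1 z <= meval fg.2 z) <-> tight G t r.1.1 z.

Local Notation trees out := [seq r.1.1 | r : result R n k <- out].
Local Notation queued Q0 := [seq x.1.2 | x : item R n k <- Q0].

(** Output and queue together are distinct shortest-path trees, hence at most sigma many, and every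
    round outputs one. So fuel plus output exceeding sigma rules out that the fuel ends first. *)
Lemma wp_main_loop al B : (forall v w, ((v, w) \in al) = is_arc G v w) -> size al = m ->
  (B + sigma * (item_words n k + system_words m k) + scratch_words n k <= P)%N ->
  forall fuel (Q0 : seq (item R n k)) seen (out : seq (result R n k)) l T Q,
  let sl := trees out ++ queued Q0 in
  (forall x, x \in Q0 -> good_item x) -> seen_ok seen sl -> uniq sl ->
  (forall f, f \in sl -> spt G t f) ->
  (forall r, r \in out -> good_result r /\ swapped r.1.1 sl) ->
  (sigma < fuel + size out)%N ->
  (l <= B + size sl * item_words n k + size out * system_words m k)%N ->
  (forall out' l' T', let sl' := trees out' in
    {subset sl <= sl'} -> uniq sl' -> (forall f, f \in sl' -> spt G t f) ->
    (forall r, r \in out' -> good_result r /\ swapped r.1.1 sl') ->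
    (T' <= T + (size out' - size out) * tree_time n k m + 1)%N -> (size out <= size out')%N ->
    Q (Some out') l' T') ->
  wp P (main_loop G t fuel al Q0 seen out) l T Q.
Proof.
move=> hal sal BP.
have sizes (Q0 : seq (item R n k)) (out : seq (result R n k)) :
    uniq (trees out ++ queued Q0) -> (forall f, f \in trees out ++ queued Q0 -> spt G t f) ->
    (size out + size Q0 <= sigma)%N.
  by move=> us ss; have := spts_size us ss; rewrite size_cat !size_map.
elim=> [|fuel IH] Q0 seen out l T Q sl gQ so us ss gout fuelE lB HQ.
  have := leq_trans (leq_addr _ _) (sizes _ _ us ss).
  by rewrite leqNgt; move: fuelE; rewrite add0n => ->.
have lB' : (l <= B + (size out + size Q0) * item_words n k + size out * system_words m k)%N.
  by move: lB; rewrite /sl size_cat !size_map.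
have lP : (l <= P)%N := main_room (sizes _ _ us ss) BP lB'.
apply: wp_op_bind => //.
case: Q0 @sl gQ so us ss gout lB lB' HQ => [|[[ord par] p] Q0] sl gQ so us ss gout lB lB' HQ.
  apply: wp_ret => //; rewrite /sl cats0 in so us ss gout HQ.
  by apply: HQ => //; clear; lia.
have gx : good_item (ord, par, p) by apply: gQ; rewrite inE eqxx.
apply: wp_bind; apply: (wp_process (B := (B + size out * system_words m k)%N) hal sal gx so us ss).
- by rewrite addnAC.
- exact: process_room (sizes _ _ us ss) BP.
move=> new seen' sys l' T' sl' gnew so' us' ss' sw hsys hl hT.
have slE : sl' = trees (rcons out (par, p, sys)) ++ queued (Q0 ++ new).
  by rewrite /sl' /sl map_rcons cat_rcons map_cat /= -catA.
rewrite slE in so' us' ss' sw hl.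
have hl' : (l' <= B +
    size (trees (rcons out (par, p, sys)) ++ queued (Q0 ++ new)) * item_words n k +
    size (rcons out (par, p, sys)) * system_words m k)%N.
  by apply: leq_trans hl _; rewrite size_rcons mulSn; apply: eq_leq; clear; ring.
have lP' : (l' <= P)%N.
  apply: (main_room (sizes _ _ us' ss') BP).
  by move: hl'; rewrite {1}size_cat !size_map.
apply: wp_free_bind => //; apply: wp_op_bind; first by room lP'.
apply: IH => //.
- move=> x; rewrite mem_cat => /orP[xQ|/gnew //]; apply: gQ; by rewrite inE xQ orbT.
- move=> r; rewrite mem_rcons inE => /orP[/eqP ->|rout].
    split=> //; split=> //=; by case: gx.
  have [gr swr] := gout r rout; split=> // v w vw inc sp'.
  rewrite -slE mem_cat; apply/orP; left; exact: swr.
- by rewrite size_rcons addnS -addSn.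
- exact: leq_trans (leq_subr _ _) hl'.
move=> out' l2 T2 sl2 sub2 us2 ss2 gout2; rewrite size_rcons => hT2 so2.
apply: HQ => //; last exact: ltnW.
  by move=> f fs; apply: sub2; rewrite -slE mem_cat fs.
exact: tree_time_bound so2 hT hT2.
Qed.

End MainLoop.
(** * Dijkstra's algorithm *)

Section Dijkstra.
Variables (R : realType) (n k : nat) (G : network R n k) (t : 'I_n) (P : nat).
Implicit Types (u v w x : 'I_n) (ord : seq 'I_n).
Hypotheses (sep : separated_variables G) (gen : generic G).

Definition lo_weight v u : \bar R := match D G v u with
  | Infty => +oo%E
  | Const c => c%:E
  | Var i => (lo G i)%:E
  end.

Lemma lo_weight_arc v u : is_arc G v u ->
  lo_weight v u = (meval (wmono (D G v u)) (lo_point G))%:E.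
Proof.
move=> vu; rewrite -weval_arc // /lo_weight; case: (D G v u) => //= i.
by rewrite mxE.
Qed.

Lemma lo_weight_not_arc v u : ~~ is_arc G v u -> lo_weight v u = +oo%E.
Proof. by rewrite /is_arc /lo_weight; case: (D G v u). Qed.

Lemma lo_weight_ge0 v u : (0 <= lo_weight v u)%E.
Proof.
have [vu|/lo_weight_not_arc ->] := boolP (is_arc G v u); last exact: leey.
rewrite lo_weight_arc // lee_fin ltW // wmono_gt0 //; exact: feasible_lo_point.
Qed.

Lemma le_lo_weight v u (d : \bar R) : (d <= lo_weight v u + d)%E.
Proof. by rewrite leeDr ?lo_weight_ge0. Qed.

(** [inv_sorted] is why settled nodes never need an update: their distances do not exceed that of
    the next node. [inv_start] makes t the first node settled, the only one at finite distance until
    then. *)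
Record dijkstra_inv (d : {ffun 'I_n -> \bar R}) (par : {ffun 'I_n -> 'I_n}) ord : Prop := {
  inv_uniq : uniq ord;
  inv_root : par t = t /\ d t = 0%E;
  inv_ge0 : forall v, (0 <= d v)%E;
  inv_parent : forall v, v != t -> (d v < +oo)%E ->
    par v \in ord /\ d v = (lo_weight v (par v) + d (par v))%E;
  inv_relaxed : forall u v, u \in ord -> (d v <= lo_weight v u + d u)%E;
  inv_sorted : forall u v, u \in ord -> v \notin ord -> (d u <= d v)%E;
  inv_finite : forall v, v \in ord -> (d v < +oo)%E;
  inv_order : forall v, v \in ord -> v != t -> subseq [:: par v; v] ord;
  inv_start : t \in ord \/ forall v, v != t -> d v = +oo%E }.

Lemma dijkstra_inv0 : dijkstra_inv (upd [ffun=> +oo%E] t 0%E) [ffun=> t] [::].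
Proof.
have tE : upd [ffun=> +oo%E : \bar R] t 0%E t = 0%E by rewrite ffunE eqxx.
have ntE v : v != t -> upd [ffun=> +oo%E : \bar R] t 0%E v = +oo%E.
  by move=> vt; rewrite !ffunE (negPf vt).
split=> //; first by rewrite ffunE.
- by move=> v; have [->|/ntE ->] := eqVneq v t; rewrite ?tE // leey.
- by move=> v /ntE ->; rewrite ltxx.
- by right.
Qed.

Definition improves (d : {ffun 'I_n -> \bar R}) ord u v : bool :=
  (v \notin ord) && (lo_weight v u + d u < d v)%E.

Definition relax_dist (d : {ffun 'I_n -> \bar R}) ord u : {ffun 'I_n -> \bar R} :=
  [ffun v => if improves d ord u v then (lo_weight v u + d u)%E else d v].

Definition relax_parent d (par : {ffun 'I_n -> 'I_n}) ord u : {ffun 'I_n -> 'I_n} :=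
  [ffun v => if improves d ord u v then u else par v].

Lemma dijkstra_inv_step d par ord u : dijkstra_inv d par ord -> u \notin ord ->
  (d u < +oo)%E -> (forall v, v \notin ord -> (d u <= d v)%E) ->
  dijkstra_inv (relax_dist d (rcons ord u) u) (relax_parent d par (rcons ord u) u) (rcons ord u).
Proof.
move=> I uord du umin; have [pt dt] := inv_root I.
have mem v : (v \in rcons ord u) = (v == u) || (v \in ord) by rewrite mem_rcons inE.
have dE v : v \in rcons ord u -> relax_dist d (rcons ord u) u v = d v.
  by move=> vo; rewrite ffunE /improves vo.
have pE v : v \in rcons ord u -> relax_parent d par (rcons ord u) u v = par v.
  by move=> vo; rewrite ffunE /improves vo.
have dle v : (relax_dist d (rcons ord u) u v <= d v)%E.
  by rewrite ffunE; case: ifP => // /andP[_ /ltW].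
have tord : t \in rcons ord u.
  rewrite mem; case: (inv_start I) => [->|h]; first by rewrite orbT.
  by have [//|ut] := eqVneq t u; move: du; rewrite h 1?eq_sym // ltxx.
have uu : u \in rcons ord u by rewrite mem eqxx.
have ordS v : v \in ord -> v \in rcons ord u by move=> vo; rewrite mem vo orbT.
split.
- by rewrite rcons_uniq uord (inv_uniq I).
- by rewrite pE // dE.
- move=> v; rewrite ffunE; case: ifP => _; last exact: (inv_ge0 I).
  by rewrite adde_ge0 ?lo_weight_ge0 // (inv_ge0 I).
- move=> v vt; rewrite (ffunE _ v) (ffunE _ v); case: ifPn => [_ _|_ dv]; first by rewrite uu dE.
  have [pv ->] := inv_parent I vt dv; by rewrite ordS // dE ?ordS.
- move=> x v; rewrite mem => /orP[/eqP ->|xo]; last first.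
    by rewrite (dE x) ?ordS //; apply: le_trans (dle v) _; exact: (inv_relaxed I).
  rewrite (dE u) // ffunE /improves mem; case: ltP => [_|le]; last first.
    by rewrite andbF.
  rewrite andbT; case: eqVneq => [->|vu] /=; first exact: le_lo_weight.
  case: (boolP (v \in ord)) => vo //=.
  exact: le_trans (inv_sorted I vo uord) (le_lo_weight _ _ _).
- move=> x v xo; rewrite mem negb_or => /andP[vu vo]; rewrite (dE x) //.
  have xu : (d x <= d u)%E.
    by move: xo; rewrite mem => /orP[/eqP ->//|xo]; exact: (inv_sorted I).
  apply: (le_trans xu); rewrite ffunE; case: ifP => _; [exact: le_lo_weight | exact: umin].
- move=> v vo; rewrite dE //; move: vo; rewrite mem => /orP[/eqP ->//|].
  exact: (inv_finite I).
- move=> v vo vt; rewrite pE //; move: vo; rewrite mem => /orP[/eqP vu|vo]; last first.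
    by apply: subseq_trans (subseq_rcons _ _); exact: (inv_order I).
  have [pu _] := inv_parent I vt (eq_ind_r (fun x => d x < +oo)%E du vu).
  by rewrite -cats1 -cat1s; apply: cat_subseq; rewrite sub1seq // vu inE.
- by left.
Qed.

Lemma dijkstra_inv_full d par ord : dijkstra_inv d par ord -> size ord = n ->
  [/\ topo t ord par, intree G t par & tight G t par (lo_point G)].
Proof.
move=> I so; have [pt dt] := inv_root I.
have ao v : v \in ord.
  have [] := uniq_min_size (inv_uniq I) (s2 := enum 'I_n).
  - by move=> x _; rewrite mem_enum.
  - by rewrite size_enum_ord so.
  by move=> _ ->; rewrite mem_enum.
have tp : topo t ord par.
  split=> //; [exact: (inv_uniq I) | by move=> u ut; exact: (inv_order I)].
have rp := topo_rooted tp.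
have arc v : v != t -> is_arc G v (par v).
  move=> vt; have dv := inv_finite I (ao v); have [_ dE] := inv_parent I vt dv.
  apply: contraLR dv => /lo_weight_not_arc w; rewrite dE w.
  by have := inv_ge0 I (par v); case: (d (par v)).
have dE v : d v = (meval (pd G t par v) (lo_point G))%:E.
  elim/(@rooted_ind _ t par): v => //; first by rewrite dt pd_root // meval0.
  move=> v vt IH; have [_ ->] := inv_parent I vt (inv_finite I (ao v)).
  by rewrite IH lo_weight_arc ?arc // [in RHS]pd_step // mevalD.
split=> //.
move=> v w vw; have := inv_relaxed I v (ao w).
by rewrite !dE lo_weight_arc // -EFinD lee_fin.
Qed.

(** A path from an unsettled node to t would contain an arc from an unsettled to a settled node, and
    relaxation would have made the distance of its tail finite. *)
Lemma dijkstra_inv_stuck d par ord : dijkstra_inv d par ord ->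
  (forall v, v \notin ord -> d v = +oo%E) -> size ord <> n ->
  exists v, ~~ connect (is_arc G) v t.
Proof.
move=> I stuck so; have [_ dt] := inv_root I.
have tord : t \in ord by apply/negPn/negP => /stuck; rewrite dt.
have [v vo] : exists v, v \notin ord.
  apply: contrapT => h; apply: so; rewrite -(card_uniqP (inv_uniq I)) -[RHS]card_ord.
  by apply: eq_card => v; apply/idP; apply/negPn/negP => vo; apply: h; exists v.
exists v; apply/negP => /connectP [p + tE]; elim: p v vo tE => [|x p IH] v vo /=.
  by move=> tE; rewrite -tE tord in vo.
move=> tE /andP[vx px]; apply: (IH x) => //; apply/negP => xo.
have := inv_relaxed I v xo; rewrite (stuck v vo) lo_weight_arc //.
by have := inv_finite I xo; have := inv_ge0 I x; case: (d x).
Qed.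

Definition dijkstra_time : nat := (4 * n + n * (14 * n + 4) + 2)%N.

Lemma wp_dijkstra l T Q : (l + 4 * n <= P)%N ->
  (forall ord par T', (T' <= T + dijkstra_time)%N ->
    (if size ord == n then
       [/\ topo t ord par, intree G t par & tight G t par (lo_point G)]
     else exists v, ~~ connect (is_arc G) v t) ->
    Q (ord, par) (l + 2 * n)%N T') ->
  wp P (dijkstra G t) l T Q.
Proof.
move=> lP HQ; rewrite /dijkstra; apply: wp_alloc_bind => //; wp_step; apply: wp_bind.
pose state := ({ffun 'I_n -> \bar R} * {ffun 'I_n -> 'I_n} * {ffun 'I_n -> bool} * seq 'I_n)%type.
(* Either every round so far settled a node, or all unsettled nodes are at infinite distance and the
   remaining rounds change nothing. *)
apply: (wp_for (c := (14 * n + 4)%N) (Inv := fun s1 (st : state) l' =>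
  let: (d, par, settled, ord) := st in
  [/\ l' = (l + 4 * n)%N, dijkstra_inv d par ord, forall v, settled v = (v \in ord)
    & size ord = size s1 \/ forall v, v \notin ord -> d v = +oo%E])).
- by split=> //; [exact: dijkstra_inv0 | move=> v; rewrite ffunE | left].
- by move=> s1 [[[d par] settled] ord] l' [->].
- move=> s1 i0 s2 [[[d par] settled] ord] _ T1 _ [-> I sE so].
  apply: wp_bind; apply: (wp_for (c := 5) (Inv := fun s1' (best : option 'I_n) l' =>
    l' = (l + 4 * n)%N /\ if best is Some u then
      [/\ u \notin ord, (d u < +oo)%E & forall v, v \in s1' -> v \notin ord -> (d u <= d v)%E]
    else forall v, v \in s1' -> v \notin ord -> d v = +oo%E)).
  + by [].
  + by move=> ? ? ? [->].
  + move=> s1' u s2' best _ T2 _ [-> hb]; wp_step; rewrite sE; case: ifPn => uo.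
      apply: wp_ret => //; split; last by clear; lia.
      split=> //; case: best hb => [u0|] => [[u0o du0 hb]|hb].
        by split=> // v; rewrite mem_rcons inE => /orP[/eqP ->|/hb //]; rewrite uo.
      by move=> v; rewrite mem_rcons inE => /orP[/eqP ->|/hb //]; rewrite uo.
    wp_step; apply: wp_bind; set c0 := (X in wp _ X).
    apply: (@wp_conseq _ _ c0 _ _ (fun d0 l' T' => [/\ l' = (l + 4 * n)%N,
      (T' <= T2 + 3)%N & d0 = if best is Some u0 then d u0 else +oo%E])).
      rewrite /c0; case: best {c0 hb} => [u0|]; [apply: wp_op | apply: wp_ret] => //;
        by split=> //; clear; lia.
    move=> {c0} d0 _ T3 [-> hT3 ->]; wp_step; apply: wp_ret => //; split; last by room hT3.
    split=> //; case: best hb => [u0|] => [[u0o du0 hb]|hb]; case: ltP => c.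
    * split=> //; first exact: lt_trans c du0.
      move=> v; rewrite mem_rcons inE => /orP[/eqP ->//|vs vo].
      exact: le_trans (ltW c) (hb v vs vo).
    * by split=> // v; rewrite mem_rcons inE => /orP[/eqP -> //|/hb].
    * split=> // v; rewrite mem_rcons inE => /orP[/eqP ->//|vs vo].
      by rewrite (hb v vs vo) leey.
    * move=> v; rewrite mem_rcons inE => /orP[/eqP -> _|/hb //].
      by apply/le_anti; rewrite leey.
  move=> [u|] _ T2 [-> hb]; rewrite size_enum_ord => hT2; last first.
    apply: wp_ret => //; split; last by room hT2.
    by split=> //; right=> v; apply: hb; rewrite mem_enum.
  have [uo du umin] := hb.
  do 3 wp_step; apply: wp_bind.
  pose ord' := rcons ord u.
  have sE' v : upd settled u true v = (v \in ord').
    by rewrite ffunE mem_rcons inE sE; case: eqP.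
  apply: (wp_for (c := 9)
    (Inv := fun s1' (dp : {ffun 'I_n -> \bar R} * {ffun 'I_n -> 'I_n}) l' =>
    [/\ l' = (l + 4 * n)%N,
      forall v, dp.1 v = if (v \in s1') && improves d ord' u v then (lo_weight v u + d u)%E else d v
    & forall v, dp.2 v = if (v \in s1') && improves d ord' u v then u else par v])).
  + by [].
  + by move=> ? ? ? [->].
  + move=> s1' v s2' [d1 par1] _ T3 eE [-> /= hd hp].
    have vs : v \notin s1'.
      have := enum_uniq 'I_n; rewrite eE cat_uniq => /and3P[_ + _] /=.
      by rewrite negb_or => /andP[].
    wp_step; rewrite sE'; case: ifPn => vo.
      apply: wp_ret => //; split; last by clear; lia.
      split=> //= x; rewrite ?hd ?hp mem_rcons inE; have [->|//] := eqVneq x v;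
        by rewrite (negPf vs) /improves vo.
    wp_step; apply: wp_bind; set c0 := (X in wp _ X).
    apply: (@wp_conseq _ _ c0 _ _ (fun y l' T' => [/\ l' = (l + 4 * n)%N,
      (T' <= T3 + 3)%N & y = lo_weight v u])).
      rewrite /c0 /lo_weight; case: (D G v u) {c0} => [|c|i];
        [apply: wp_ret | apply: wp_ret | apply: wp_op] => //; by split=> //; clear; lia.
    move=> {c0} y _ T4 [-> hT4 ->]; do 3 wp_step; rewrite hd (negPf vs) /=.
    have impE : improves d ord' u v = (lo_weight v u + d u < d v)%E by rewrite /improves vo.
    rewrite -impE; case: ifPn => imp.
      do 2 wp_step; apply: wp_ret => //; split; last by room hT4.
      split=> //= x; rewrite ffunE ?hd ?hp mem_rcons inE;
        by have [->|//] := eqVneq x v; rewrite imp.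
    apply: wp_ret => //; split; last by room hT4.
    split=> //= x; rewrite ?hd ?hp mem_rcons inE;
      by have [->|//] := eqVneq x v; rewrite (negPf vs) (negPf imp).
  move=> [d1 par1] _ T3 [-> /= hd hp]; rewrite size_enum_ord => hT3.
  have -> : d1 = relax_dist d ord' u by apply/ffunP => v; rewrite hd mem_enum ffunE.
  have -> : par1 = relax_parent d par ord' u by apply/ffunP => v; rewrite hp mem_enum ffunE.
  apply: wp_ret => //; split; last by move: hT2 hT3; clear; lia.
  split=> //; first by apply: dijkstra_inv_step => // v vo; apply: umin; rewrite ?mem_enum.
  left; rewrite !size_rcons; case: so => [->//|/(_ u uo) uoo].
  by rewrite uoo ltxx in du.
move=> [[[d par] settled] ord] _ T1 [-> I sE so]; rewrite size_enum_ord => hT1.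
apply: wp_free_bind => //; apply: wp_ret; first by room lP.
have -> : (l + 4 * n - 2 * n = l + 2 * n)%N by clear; lia.
apply: HQ; first by move: hT1; rewrite /dijkstra_time; clear; lia.
rewrite size_enum_ord in so; case: eqP => son; first exact: (dijkstra_inv_full I).
by apply: (dijkstra_inv_stuck I) => //; case: so.
Qed.

End Dijkstra.
(** * The traversal *)

Definition peak_bound n k m s : nat :=
  (2 * m + s * (item_words n k + system_words m k) + scratch_words n k + 4 * n)%N.

(** Kept apart from [run_time] because it is all that is spent when some node cannot reach t. *)
Definition setup_time n : nat := (arc_list_time n + dijkstra_time n + 4)%N.

Definition run_time n k m s : nat :=
  (setup_time n + distances_time n k + (3 * m.+1 + 5 * n + 1) + s * tree_time n k m + 10)%N.

Section Traversal.
Variables (R : realType) (n k : nat) (G : network R n k) (t : 'I_n).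
Implicit Types (f : {ffun 'I_n -> 'I_n}) (v w : 'I_n) (out : seq (result R n k)).
Hypotheses (sep : separated_variables G) (gen : generic G).

Local Notation m := #|arcs G|.
Local Notation sigma := #|spts G t|.
Local Notation trees out := [seq r.1.1 | r : result R n k <- out].

Lemma intree_connect f v : intree G t f -> connect (is_arc G) v t.
Proof.
move=> [rf af]; elim/(@rooted_ind _ t f): v => // v vt; apply: connect_trans.
by apply: connect1; exact: af.
Qed.

Lemma tree_ofE (r : result R n k) : tree_of t r = arcset t r.1.1.
Proof. by []. Qed.

Lemma system_of_cell (r : result R n k) : r.1.1 t = t -> good_result G t r ->
  system_of G r = cell G t (arcset t r.1.1).
Proof.
move=> rt [_ h]; apply/seteqP; split=> z.
  by move=> [fz sz]; apply/cell_arcset => //; split=> //; exact/h.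
by move=> /(cell_arcset G z rt) [fz tz]; split=> //; exact/h.
Qed.

Lemma correct_output_trees f0 out : intree G t f0 -> tight G t f0 (lo_point G) ->
  f0 \in trees out -> uniq (trees out) -> (forall f, f \in trees out -> spt G t f) ->
  (forall r, r \in out -> good_result G t r /\ swapped G t r.1.1 (trees out)) ->
  correct_output G t out.
Proof.
move=> itf0 tf0 f0out ut st gout.
have rootP r : r \in out -> r.1.1 t = t.
  by move=> rout; have [[[]]] := st _ (map_f (fun r : result R n k => r.1.1) rout).
have cP : swap_closed G t (fun f => f \in trees out).
  move=> f v w /mapP [r rout ->] vw inc sp; by have [_ sw] := gout r rout; exact: sw.
have findP g z : intree G t g -> interior_point G z -> tight G t g z ->
    exists2 r, r \in out & r.1.1 = g.
  move=> itg iz tg; have := swap_closed_complete sep gen cP f0out itf0 tf0 itg iz tg.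
  by move=> /mapP [r rout ->]; exists r.
split.
- have -> : [seq tree_of t r | r <- out] = map (arcset t) (trees out) by rewrite -map_comp.
  rewrite map_inj_in_uniq // => f g fo go; apply: arcset_inj.
    by have [[[ft _] _] _] := st f fo; rewrite inE ft.
  by have [[[ft _] _] _] := st g go; rewrite inE ft.
- move=> r rout; have [gr _] := gout r rout; have rt := rootP r rout.
  split; last exact: system_of_cell.
    rewrite SPT_spts; apply/imsetP; exists r.1.1 => //.
    by apply/sptsP/st/map_f.
  by move=> v; rewrite tree_ofE tdist_arcset //; have [-> _] := gr.
- move=> T; rewrite SPT_spts => /imsetP [f /sptsP [itf _] ->] [z iz].
  have ft : f t = t by case: itf => -[].
  have [iz' tz] := interior_cell_point ft iz.
  by have [r rout rf] := findP f z itf iz' tz; exists r; rewrite // tree_ofE rf.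
- move=> S rS; have [f [z [itf iz tz ->]]] := region_cell sep gen itf0 rS.
  have [r rout <-] := findP f z itf iz tz; exists r => //.
  have [gr _] := gout r rout; exact: system_of_cell (rootP r rout) gr.
Qed.

Lemma correct_output_nil v : ~~ connect (is_arc G) v t -> correct_output G t [::].
Proof.
move=> nv; split=> //.
  move=> T; rewrite SPT_spts => /imsetP [f /sptsP [itf _] _].
  by rewrite (intree_connect v itf) in nv.
by move=> S /(region_connect sep gen) /(_ v); rewrite (negPf nv).
Qed.

(** The fuel allows one round for each of at most sigma trees and one that finds the queue empty. In
    the second case on the time, the tree supplies sigma > 0 and n <= m + 1; neither is available in
    the first. *)
Lemma wp_graph_traversal : wp (peak_bound n k m sigma) (graph_traversal G t sigma.+1) 0 0
  (fun r _ T => exists2 out, r = Some out & correct_output G t out /\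
     ((T <= setup_time n)%N \/ (exists f, spt G t f) /\ (T <= run_time n k m sigma)%N)).
Proof.
rewrite /graph_traversal; apply: wp_bind; apply: wp_arc_list.
  by rewrite /peak_bound; clear; lia.
move=> al T1 hal sal hT1; apply: wp_bind; apply: wp_dijkstra => //.
  by rewrite /peak_bound; clear; lia.
move=> ord par T2 hT2 hD; cbv beta iota.
have P1 : (0 + 2 * m + 2 * n + dist_size n k + 3 * n + 3 <= peak_bound n k m sigma)%N.
  by rewrite /peak_bound /scratch_words /item_words; clear; lia.
do 2 (apply: wp_op_bind; [by room P1 | cbv beta]).
move: hD; case: ifP => _ hD; last first.
  have [v nv] := hD.
  apply: wp_op_bind; first by room P1.
  apply: wp_ret; first by room P1.
  exists [::] => //; split; first exact: (correct_output_nil nv).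
  by left; move: hT1 hT2; rewrite /setup_time; clear; lia.
have [tp itp tpar] := hD; have sp := tight_lo_spt sep gen itp tpar.
apply: wp_bind; apply: wp_distances => //; first by room P1.
move=> p T3 hp hT3.
apply: wp_bind; apply: (wp_insert (ok := parent_ok G t)) => //.
- by rewrite size_enum_ord; room P1.
- by move=> u _; exact: intree_parent_ok.
move=> seen l4 T4 wT _ mT hl4 hT4; rewrite size_enum_ord in hl4 hT4.
have wc := word_cost_arcs G t.
have bw : (word_cost (parent_ok G t) (behead (enum 'I_n)) <= m.+1)%N.
  apply: leq_trans wc; rewrite /word_cost.
  by case: (enum 'I_n) => //= u us; rewrite big_cons leq_addl.
have l4P : (l4 + 3 <= peak_bound n k m sigma)%N by move: P1 hl4; clear; lia.
apply: wp_alloc_bind => //.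
have so : seen_ok G t seen [:: par].
  split=> // f; rewrite mT ?size_map // ?orbF ?inE.
    by apply/eqP/eqP => [/word_inj|->].
  by rewrite -size_eq0 size_enum_ord -lt0n (leq_ltn_trans _ (ltn_ord t)).
apply: (wp_main_loop (B := (2 * m)%N) sep gen hal sal) => //.
- by rewrite /peak_bound; clear; lia.
- by move=> x; rewrite inE => /eqP ->; split.
- by move=> f; rewrite inE => /eqP ->.
- by rewrite addn0.
- by move: hl4; rewrite /= /item_words; clear; lia.
move=> out l5 T5 sl5 sub uo so' gout hT5 _; exists out => //; split.
  have pout : par \in [seq r.1.1 | r <- out] := sub par (mem_head _ _).
  exact: (correct_output_trees itp tpar pout uo so' gout).
right; split; first by exists par.
have so5 : (size out <= sigma)%N by rewrite -(size_map (fun r : result R n k => r.1.1)) spts_size.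
have := leq_mul so5 (leqnn (tree_time n k m)); move: hT1 hT2 hT3 hT4 hT5 bw.
rewrite subn0 /run_time /setup_time [size (labels _)]/=.
move: (size out * _)%N (sigma * _)%N (word_cost _ _) => x y z.
by clear; lia.
Qed.

(** * From explicit costs to the asymptotic bounds *)

Lemma arcs_le_sqr : (m <= n ^ 2)%N.
Proof. by apply: leq_trans (max_card _) _; rewrite card_prod !card_ord. Qed.

Lemma nodes_le_arcs f : intree G t f -> (n <= m.+1)%N.
Proof.
move=> itf; have [sub _ _ _] := spanning_tree_arcset itf.
by have := subset_leq_card sub; rewrite card_arcset leq_subLR add1n.
Qed.

Lemma vars_le_arcs : (0 < k)%N -> (0 < m)%N.
Proof.
move=> k0; have [_ _ /(_ (Ordinal k0)) [a [ea _]]] := sep.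
by apply/card_gt0P; exists a; rewrite inE /is_arc ea.
Qed.

Lemma card_spts_no_var : k = 0%N -> (sigma <= 1)%N.
Proof.
move=> k0; have e : Phi n k = 1 by rewrite k0 /Phi big_ord1 bin0 mul1r exp1rz.
by have := card_spts_Phi t sep gen; rewrite e -(ler_nat rat).
Qed.

End Traversal.

(** The maxima with 1 account for the list of arcs and the tables of Dijkstra's algorithm, which
    take space even when k = 0 or s = 0. *)
Lemma peak_bound_le n k m s : (0 < n)%N ->
  (peak_bound n k m s <= 1000 * (maxn k 1 * (n + m) * maxn s 1))%N.
Proof.
move=> n0; rewrite /peak_bound; set K := maxn k 1; set S := maxn s 1.
have kK : (k <= K)%N by rewrite leq_maxl.
have K0 : (1 <= K)%N by rewrite leq_maxr.
have sS : (s <= S)%N by rewrite leq_maxl.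
have S0 : (1 <= S)%N by rewrite leq_maxr.
clearbody K S.
have nk : (n * k <= K * (n + m))%N by nia.
have mk : (m * k <= K * (n + m))%N by nia.
have nm : (n + m <= K * (n + m))%N by nia.
have kk : (k <= K * (n + m))%N by nia.
have iw : (item_words n k + system_words m k <= 20 * (K * (n + m)))%N.
  rewrite /item_words /dist_size /system_words mulnS mulnDr.
  by move: nk mk nm n0; move: (K * (n + m))%N (n * k)%N (m * k)%N; lia.
have sc : (scratch_words n k <= 20 * (K * (n + m)))%N.
  rewrite /scratch_words /item_words /dist_size mulnS.
  by move: nk kk nm n0; move: (K * (n + m))%N (n * k)%N; lia.
move: iw sc nm; move: (K * (n + m))%N (item_words n k + _)%N (scratch_words n k).
move=> x i z iw sc nm; have : (s * i <= 20 * (x * S))%N.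
  by apply: leq_trans (leq_mul sS iw) _; rewrite mulnCA [(S * x)%N]mulnC.
by have : (x <= x * S)%N; [rewrite leq_pmulr | lia].
Qed.

Lemma setup_time_le n : (0 < n)%N -> (setup_time n <= 100 * n ^ 2)%N.
Proof.
rewrite /setup_time /arc_list_time /dijkstra_time expnS expn1 => n0.
have : (n <= n * n)%N by rewrite leq_pmulr.
by lia.
Qed.

(** For k = 0 there is at most one tree and every remaining term is linear in n and m, hence O(n^2).
    For k > 0 also m > 0, so n <= 2m, and the cost per tree is bounded by a multiple of k m^2. *)
Lemma run_time_le n k m s : (0 < n)%N -> (0 < s)%N -> (n <= m.+1)%N -> (m <= n ^ 2)%N ->
  ((0 < k)%N -> (0 < m)%N) -> (k = 0%N -> (s <= 1)%N) ->
  (run_time n k m s <= 1000 * (k * m ^ 2 * s + n ^ 2))%N.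
Proof.
move=> n0 s0 nm mn km ks; have := setup_time_le n0.
rewrite /run_time; move: (setup_time n) => T0 hT0.
rewrite /distances_time /tree_time /arc_time /add_time /compare_time /pivot_time.
rewrite /distances_time /is_shortest_time /add_time /compare_time.
have nn : (n <= n ^ 2)%N by rewrite expnS expn1 leq_pmulr.
have [k0|k0] := posnP k.
  have -> : s = 1%N by have := ks k0; lia.
  by rewrite k0; move: nn mn hT0 n0; move: (n ^ 2)%N; clear; lia.
have m0 := km k0.
have [q qE] : exists q, q = (k * m ^ 2)%N by eexists.
have E1 : (k * m <= q)%N by rewrite qE expnS expn1 leq_mul2l leq_pmulr ?orbT.
have E2 : (m * m <= q)%N by rewrite qE expnS expn1 leq_pmull.
have E3 : (m <= k * m)%N by rewrite leq_pmull.
have E4 : (n * k <= 2 * (k * m))%N by nia.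
have E5 : (m * (n * k) <= 2 * q)%N.
  by have := leq_mul (leqnn m) E4; rewrite qE expnS expn1; lia.
have E6 : (m * n <= 2 * (m * m))%N by nia.
have E7 : (m * (m * k) = q)%N by rewrite qE expnS expn1; lia.
have qs : (q <= q * s)%N by rewrite leq_pmulr.
have tree : (m * (7 + k * 5 + 2 * (4 + k * 9) + 10 + (n * 20 + 3 +
   (n + n * (k.+1 + (7 + k * 5) + 7)) + m * (7 + k * 5 + (4 + k * 9) * 2 + 12) +
   5 * m + 5 * n + 30)) + 3 <= 500 * q)%N by nia.
have dist : (n + n * (k.+1 + (7 + k * 5) + 7) + (3 * m.+1 + 5 * n + 1) + 10 <= 200 * q)%N by nia.
rewrite -qE; have := leq_mul (leqnn s) tree; rewrite mulnCA [(s * q)%N]mulnC.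
move: dist qs hT0; move: (s * (m * _ + 3))%N => x.
move: (q * s)%N (n ^ 2)%N => y w; rewrite mulnDr; lia.
Qed.

Theorem theorem18 :
  exists C : nat,
  forall (R : realType) (n k : nat) (G : network R n k) (t : 'I_n),
  separated_variables G -> generic G ->
  let m := #|arcs G| in
  let sigma := #|SPT G t| in
  (sigma%:R : rat) <= Num.min (Phi n k)
                        (Num.min (n ^ (n - 2))%:R ('C(m, n - 1))%:R) /\
  exists (fuel : nat) (out : seq (result R n k)),
    let run := graph_traversal G t fuel 0%N in
    [/\ value run = Some out,
        correct_output G t out,
        (time run <= C * (k * m ^ 2 * sigma + n ^ 2))%N
      & (peak run <= C * (maxn k 1 * (n + m) * maxn sigma 1))%N].
Proof.
exists 1000%N => R n k G t sep gen m sigma.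
have -> : sigma = #|spts G t| := card_SPT G t.
split.
  by rewrite !le_min !ler_nat card_spts_Phi // card_spts_cayley card_spts_bin.
have n0 : (0 < n)%N := leq_ltn_trans (leq0n _) (ltn_ord t).
have [peakP [out vE [co timeT]]] := wp_graph_traversal t sep gen.
exists (#|spts G t|.+1), out; split=> //.
- case: timeT => [le|[[f sf] le]].
    by apply: leq_trans le (leq_trans (setup_time_le n0) _); rewrite mulnDr; lia.
  apply: leq_trans le (run_time_le n0 _ _ _ _ _).
  + by apply/card_gt0P; exists f; apply/sptsP.
  + by have [itf _] := sf; exact: nodes_le_arcs itf.
  + exact: arcs_le_sqr.
  + exact: vars_le_arcs.
  + exact: card_spts_no_var.
- exact: leq_trans peakP (peak_bound_le _ _ _ n0).
Qed.
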